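(* The two-qubit holonomic system (described in the context) is exactly universal, i.e. any element of $SU(4)$ can be implemented on the two-qubit state, if the Lie algebra generated by the local algebra and the interaction holonomy algebra $\mathfrak{hol}_{int}$ spans $\mathfrak{su}(4)$.
   Context: Holonomic system. Let $\mathcal H$ be a separable Hilbert space, $H_0$ a Hamiltonian with a $k$-dimensional degenerate eigenspace with orthonormal basis $|v_1\rangle,\dots,|v_k\rangle$, which encodes the quantum information, and $\mathcal U_k(x)$ a family of unitary control transformations depending on a point $x$ of a finite-dimensional parameter manifold $M$. The system is governed adiabatically by the isospectral family $\mathcal U_k(x)H_0\,\mathcal U_k(x)^\dagger$. Pulling back the bundle (orthonormal $k$-frames in $\mathcal H$) $\to$ (rank-$k$ orthogonal projections in $\mathcal H$) along $x\mapsto\mathcal U_k(x)\big(\sum_{j}|v_j\rangle\langle v_j|\big)\mathcal U_k(x)^\dagger$ gives a principal bundle over $M$ with the Wilczek-Zee connection $A$, whose components are $(A_{x_\mu})_{ij}=\langle v_i|\mathcal U_k(x)^\dagger\frac{\partial}{\partial x_\mu}\mathcal U_k(x)|v_j\rangle$. The holonomy of a closed curve $\gamma$ in $M$ is the path ordered exponential $\mathbf P\exp\oint_\gamma -A\,dx$; the set of all holonomies is the holonomy group, and its Lie algebra is the holonomy algebra. Logic gates are implemented by holonomies acting on the degenerate subspace. Two-qubit holonomic system. Single-qubit rotations are $SU(2)$ holonomies of such bundles with $k=2$, one for each qubit, acting on $\mathbb C^2\otimes\mathbb C^2$ as $SU(2)\otimes\mathbf 1$ and $\mathbf 1\otimes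 SU(2)$. Interactions between the two qubits are modeled as $SU(4)$ holonomies of such a bundle with $k=4$ over the two-qubit Hilbert space $\mathcal H_1\otimes\mathcal H_2$, acting on the fibre $\mathbb C^4\cong\mathbb C^2\otimes\mathbb C^2$; $\mathfrak{hol}_{int}$ denotes the holonomy algebra of this interaction bundle. Local algebra. With $I_x=\frac12\begin{pmatrix}0&1\\1&0\end{pmatrix}$, $I_y=\frac12\begin{pmatrix}0&-i\\i&0\end{pmatrix}$, $I_z=\frac12\begin{pmatrix}1&0\\0&-1\end{pmatrix}$ and $\mathbf 1$ the $2\times2$ identity, the local algebra is generated by $I_k\otimes\mathbf 1$ and $\mathbf 1\otimes I_k$, $k\in\{x,y,z\}$; it is the Lie algebra $\mathfrak{su}(2)\otimes\mathbf 1+\mathbf 1\otimes\mathfrak{su}(2)$ of the local group $SU(2)\otimes SU(2)$. Exact universality (local controllability) means that any group element can be implemented on the state of the system. *)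

(* Defs.v *)
From HB Require Import structures.
From mathcomp Require Import all_boot all_order all_algebra.
From mathcomp Require Import complex mxtens.
From mathcomp Require Import all_classical all_reals all_analysis.

Set Implicit Arguments.
Unset Strict Implicit.
Unset Printing Implicit Defensive.

Import Order.TTheory GRing.Theory Num.Theory numFieldNormedType.Exports.

Local Open Scope classical_set_scope.
Local Open Scope ring_scope.
Local Open Scope complex_scope.
Local Open Scope sesquilinear_scope.

(* R[i] is given its numClosedFieldType structure once and for all, so that the
   norm topology of numFieldNormedType and the conjugation Num.conj apply. *)
Definition Cplx (R : realType) : numClosedFieldType := R[i].

Definition realC (R : realType) (r : R) : Cplx R := r%:C.

Definition imagC (R : realType) : Cplx R := 0 +i* 1.

(** * Calculus of a real variable with values in a normed space *)

(* The scalars K of the target contain R through iota: K = R for the coordinate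
   changes of a manifold, K = C for vectors and matrices.  The library's derive
   only covers K = R. *)
Section RealCalculus.
Variables (R : realType) (K : numFieldType) (iota : R -> K).
Variable V : normedModType K.

Definition diff_quot (f : R -> V) (t h : R) : V :=
  (iota h)^-1 *: (f (t + h) - f t).

Definition has_deriv (f : R -> V) (t : R) (l : V) : Prop :=
  diff_quot f t h @[h --> (0 : R)^'] --> l.

Definition deriv_at (f : R -> V) (t : R) : V :=
  lim (diff_quot f t h @[h --> (0 : R)^']).

Variable d : nat.

Definition coord_line (f : 'rV[R]_d -> V) (mu : 'I_d) (y : 'rV[R]_d) (s : R) : V :=
  f (y + s *: delta_mx 0 mu).

Definition has_partial (f : 'rV[R]_d -> V) mu y (l : V) : Prop :=
  has_deriv (coord_line f mu y) 0 l.

Definition partial (f : 'rV[R]_d -> V) mu y : V :=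
  deriv_at (coord_line f mu y) 0.

Fixpoint class_C (n : nat) (O : set 'rV[R]_d) (f : 'rV[R]_d -> V) : Prop :=
  (forall y, O y -> {for y, continuous f}) /\
  if n is m.+1 then
    forall mu, exists2 g, (forall y, O y -> has_partial f mu y (g y))
                        & class_C m O g
  else True.

Definition smooth_on (O : set 'rV[R]_d) (f : 'rV[R]_d -> V) : Prop :=
  forall n, class_C n O f.

End RealCalculus.

(** * Manifolds *)

Record manifold (R : realType) := Manifold {
  mdim : nat;
  mpoint :> topologicalType;
  m_hausdorff : hausdorff_space mpoint;
  m_second_countable : @second_countable mpoint;
  chart : Type;
  cdom : chart -> set mpoint;
  cran : chart -> set 'rV[R]_mdim;
  cmap : chart -> mpoint -> 'rV[R]_mdim;
  cinv : chart -> 'rV[R]_mdim -> mpoint;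
  cdom_open : forall c, open (cdom c);
  cran_open : forall c, open (cran c);
  cmap_ran : forall c x, cdom c x -> cran c (cmap c x);
  cinv_dom : forall c y, cran c y -> cdom c (cinv c y);
  cmapK : forall c x, cdom c x -> cinv c (cmap c x) = x;
  cinvK : forall c y, cran c y -> cmap c (cinv c y) = y;
  cmap_cont : forall c x, cdom c x -> {for x, continuous (cmap c)};
  cinv_cont : forall c y, cran c y -> {for y, continuous (cinv c)};
  chart_cover : forall x, exists c, cdom c x;
  transition_smooth : forall c c',
    smooth_on (@idfun R) (cran c `&` cinv c @^-1` cdom c')
      (cmap c' \o cinv c : 'rV[R]_mdim -> 'rV[R]_mdim)
}.

Section Curves.
Variables (R : realType) (M : manifold R).

Definition coord (c : chart M) (gamma : R -> M) (mu : 'I_(mdim M)) : R -> R :=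
  fun t => cmap c (gamma t) 0 mu.

(* Only the restriction to [0, 1] is used, and every C^1 curve on [0, 1] is such
   a restriction.  Piecewise C^1 loops have the same holonomies as these loops:
   reparametrise them so that they come to rest at the corners. *)
Definition C1_curve (gamma : R -> M) : Prop :=
  continuous gamma /\
  forall (c : chart M) t mu, cdom c (gamma t) ->
    (\forall s \near t, derivable (coord c gamma mu) s 1) /\
    {for t, continuous (derive1 (coord c gamma mu))}.

Definition loop_at (x0 : M) (gamma : R -> M) : Prop :=
  [/\ C1_curve gamma, gamma 0 = x0 & gamma 1 = x0].

End Curves.

(** * Hilbert spaces and Hamiltonians *)

Record hilbert (R : realType) := Hilbert {
  hspace :> completeNormedModType (Cplx R);
  hdot : {dot hspace for Num.conj};
  hdot_norm : forall x, hdot x x = `|x| ^+ 2;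
  hseparable : exists s : nat -> hspace, dense (range s)
}.

(* Forms of type {dot _ for Num.conj} are linear on the left, whereas <u|w> is
   linear on the right. *)
Definition braket (R : realType) (H : hilbert R) (u w : H) : Cplx R :=
  hdot H w u.

(* A self-adjoint, possibly unbounded operator: the values of ham outside
   ham_dom are irrelevant, and ham_selfadjoint says that ham is equal to its
   adjoint, domains included. *)
Record hamiltonian (R : realType) (H : hilbert R) := Hamiltonian {
  ham_dom : set H;
  ham : H -> H;
  ham_dense : dense ham_dom;
  ham_linear : forall (a : Cplx R) x y, ham_dom x -> ham_dom y ->
    ham_dom (a *: x + y) /\ ham (a *: x + y) = a *: ham x + ham y;
  ham_selfadjoint : forall y z,
    (forall x, ham_dom x -> braket (ham x) y = braket x z) <->
    (ham_dom y /\ ham y = z)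
}.

Definition eigenspace (R : realType) (H : hilbert R) (h : hamiltonian H)
    (E : R) : set H :=
  [set x | ham_dom h x /\ ham h x = realC E *: x].

(* The completed tensor product of Hilbert spaces, which these properties
   determine up to unique isomorphism. *)
Record hilbert_tensor (R : realType) (H1 H2 H : hilbert R) := HilbertTensor {
  tens :> H1 -> H2 -> H;
  tens_linearl : forall (a : Cplx R) x x' y,
    tens (a *: x + x') y = a *: tens x y + tens x' y;
  tens_linearr : forall (a : Cplx R) x y y',
    tens x (a *: y + y') = a *: tens x y + tens x y';
  tens_braket : forall x x' y y',
    braket (tens x y) (tens x' y') = braket x x' * braket y y';
  tens_dense : dense [set z : H | exists n (x : 'I_n -> H1) (y : 'I_n -> H2),
                        z = \sum_(i < n) tens (x i) (y i)]
}.

(** * Holonomic systems *)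

(* x |-> (ctrl x (frame j))_j is a section of the bundle of orthonormal k-frames
   pulled back to the parameter manifold; only this section, not the operator
   ctrl x itself, is required to depend smoothly on x, as ctrl may have unbounded
   generators.  Holonomies are taken at the point hs_base. *)
Record holonomic_system (R : realType) (H : hilbert R) (k : nat) :=
  HolonomicSystem {
  hs_ham : hamiltonian H;
  hs_energy : R;
  frame : 'I_k -> H;
  frame_orthonormal : forall i j, braket (frame i) (frame j) = (i == j)%:R;
  frame_spans : eigenspace hs_ham hs_energy =
    [set x | exists a : 'I_k -> Cplx R, x = \sum_(j < k) a j *: frame j];
  hs_param : manifold R;
  hs_base : hs_param;
  ctrl : hs_param -> {linear H -> H};
  ctrl_adj : hs_param -> H -> H;
  ctrl_adjoint : forall x u w,
    braket (ctrl_adj x u) w = braket u (ctrl x w);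
  ctrl_adjK : forall x u, ctrl_adj x (ctrl x u) = u;
  ctrlK : forall x u, ctrl x (ctrl_adj x u) = u;
  ctrl_smooth : forall (c : chart hs_param) j,
    smooth_on (@realC R) (cran c) (fun y => ctrl (cinv c y) (frame j))
}.

Section Holonomy.
Variables (R : realType) (H : hilbert R) (k : nat) (S : holonomic_system H k).
Let M := hs_param S.

Definition wilczek_zee (c : chart M) (mu : 'I_(mdim M)) (x : M)
    : 'M[Cplx R]_k :=
  \matrix_(i, j) braket (frame S i)
    (ctrl_adj x (partial (@realC R) (fun y => ctrl (cinv c y) (frame S j))
                   mu (cmap c x))).

(* W is the path ordered exponential P exp (int_gamma - A dx): the value at 1 of
   the solution of g' = - A(gamma') g, g(0) = 1. *)
Definition path_ordered_exp (gamma : R -> M) (W : 'M[Cplx R]_k) : Prop :=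
  exists g : R -> 'M[Cplx R]_k,
    [/\ g 0 = 1%:M, g 1 = W, {within `[0, 1], continuous g} &
        forall (t : R) (c : chart M), 0 < t < 1 -> cdom c (gamma t) ->
          has_deriv (@realC R) g t
            ((- \sum_mu realC (derive1 (coord c gamma mu) t)
                          *: wilczek_zee c mu (gamma t)) *m g t)].

Definition holonomy_group : set 'M[Cplx R]_k :=
  [set W | exists2 gamma, loop_at (hs_base S) gamma & path_ordered_exp gamma W].

End Holonomy.

(** * Matrix groups and Lie algebras *)

Section MatrixLie.
Variable R : realType.
Local Notation C := (Cplx R).

Definition SU n : set 'M[C]_n := [set W | W \is unitarymx /\ \det W = 1].

Definition su n : set 'M[C]_n := [set X | X ^t* = - X /\ \tr X = 0].

(* Tangent vectors at 1 of the C^1 curves lying in G.  G need not be closed; for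
   a Lie subgroup with countably many components, such as a holonomy group, such
   curves are also C^1 for the Lie group structure of G. *)
Definition lie_algebra_of n (G : set 'M[C]_n) : set 'M[C]_n :=
  [set X | exists c c' : R -> 'M[C]_n,
     [/\ forall t, G (c t), forall t, has_deriv (@realC R) c t (c' t),
         continuous c', c 0 = 1%:M & c' 0 = X]].

Definition holonomy_algebra (H : hilbert R) k (S : holonomic_system H k)
    : set 'M[C]_k :=
  lie_algebra_of (holonomy_group S).

Definition real_lie_subalgebra n (L : set 'M[C]_n) : Prop :=
  [/\ L 0,
      forall X Y, L X -> L Y -> L (X + Y),
      forall (r : R) X, L X -> L (realC r *: X) &
      forall X Y, L X -> L Y -> L (X *m Y - Y *m X)].

Definition lie_generated n (A : set 'M[C]_n) : set 'M[C]_n :=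
  smallest (@real_lie_subalgebra n) A.

Definition Ix : 'M[C]_2 := 2^-1 *: (delta_mx 0 1 + delta_mx 1 0).
Definition Iy : 'M[C]_2 := 2^-1 *: (imagC R *: (delta_mx 1 0 - delta_mx 0 1)).
Definition Iz : 'M[C]_2 := 2^-1 *: (delta_mx 0 0 - delta_mx 1 1).

Definition kron (A B : 'M[C]_2) : 'M[C]_4 := A *t B.

(* su(n) consists of skew-Hermitian matrices here, so that the Hermitian
   generators I_k enter through i I_k. *)
Definition local_algebra : set 'M[C]_4 :=
  lie_generated ([set kron (imagC R *: I) 1%:M | I in [set Ix; Iy; Iz]] `|`
                 [set kron 1%:M (imagC R *: I) | I in [set Ix; Iy; Iz]]).

End MatrixLie.

Arguments SU R n : clear implicits.
Arguments su R n : clear implicits.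
Arguments local_algebra R : clear implicits.

(** * Two-qubit holonomic systems *)

Record two_qubit_system (R : realType) := TwoQubitSystem {
  space1 : hilbert R;
  space2 : hilbert R;
  space12 : hilbert R;
  space_tens : hilbert_tensor space1 space2 space12;
  qubit1 : holonomic_system space1 2;
  qubit2 : holonomic_system space2 2;
  interaction : holonomic_system space12 4;
  qubit1_SU2 : holonomy_group qubit1 = SU R 2;
  qubit2_SU2 : holonomy_group qubit2 = SU R 2;
  interaction_SU4 : holonomy_group interaction `<=` SU R 4;
  (* the identification C^4 = C^2 (x) C^2 of the fibres *)
  interaction_frame : forall i j, frame interaction (@mxtens_index 2 2 (i, j)) =
    space_tens (frame qubit1 i) (frame qubit2 j)
}.

Section Universality.
Variables (R : realType) (S : two_qubit_system R).

Definition gate : set 'M[Cplx R]_4 :=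
  [set kron W 1%:M | W in holonomy_group (qubit1 S)] `|`
  [set kron 1%:M W | W in holonomy_group (qubit2 S)] `|`
  holonomy_group (interaction S).

(* The gates are applied from right to left. *)
Definition implementable (W : 'M[Cplx R]_4) : Prop :=
  exists2 s : seq 'M[Cplx R]_4,
    (forall h, h \in s -> gate h) & W = \big[mulmx/1%:M]_(h <- s) h.

Definition exactly_universal : Prop := forall W, SU R 4 W -> implementable W.

End Universality.

(* Main.v *)
(* Let G be the set of implementable matrices and T the set of velocities at 1
   of C^1 curves in G.  Running a loop backwards inverts its holonomy, so G is a
   group; it lies in SU(4), and T is then a Lie algebra: it is stable under
   X |-> g X g^-1 for g in G, and differentiating c(t) Y c(t)^-1, a curve in a
   linear subspace of a finite-dimensional space, gives the bracket [X, Y].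
   Since T contains the local algebra and the interaction holonomy algebra,
   T = su(4).

   It remains to see that a subgroup G of SU(n) with T = su(n) is all of SU(n),
   although G is not known to be closed.  Adjoining the scalars of modulus 1 to
   G, the velocities become all skew-Hermitian matrices.  Choose curves c_k in
   the enlarged group whose velocities are the skew-Hermitian parts of the real
   basis of the n x n matrices.  The map
     v |-> (prod_k c_k (v_k)) (1 + Hermitian part of v)
   has derivative the identity at 0, hence is onto a neighbourhood of 1 by
   Banach's fixed point theorem.  If its value at v is unitary then so is the
   Hermitian factor, which is close to 1 and so equal to 1; thus the enlarged
   group contains a neighbourhood of 1 in U(n), and it is U(n) because every
   unitary matrix has roots close to 1.  Finally each W in SU(n) is z g with g
   in G and z^n = 1, and the scalar matrix z is the n-th power of some
   V in SU(n); as V = z' g' with z'^n = 1, this power is g'^n, hence in G. *)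

From HB Require Import structures.
Require Import Defs.
From mathcomp Require Import all_boot all_order all_algebra.
From mathcomp Require Import complex mxtens spectral.
From mathcomp Require Import all_classical all_reals all_analysis.
From mathcomp Require Import ring lra.

Set Implicit Arguments.
Unset Strict Implicit.
Unset Printing Implicit Defensive.

Import Order.TTheory GRing.Theory Num.Theory numFieldNormedType.Exports.

Local Open Scope classical_set_scope.
Local Open Scope ring_scope.
Local Open Scope sesquilinear_scope.

(** * Differential calculus of matrix curves *)

Section ReIm.
Variable R : realType.
Local Notation C := (Cplx R).
Implicit Types z w : C.

(* complex.Re and complex.Im are additive on the alias Rcomplex R only. *)
Definition re (z : C) : R := complex.Re z.
Definition im (z : C) : R := complex.Im z.

Lemma reD z w : re (z + w) = re z + re w. Proof. by case: z w => [? ?] []. Qed.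
Lemma imD z w : im (z + w) = im z + im w. Proof. by case: z w => [? ?] []. Qed.
Lemma reN z : re (- z) = - re z. Proof. by case: z. Qed.
Lemma imN z : im (- z) = - im z. Proof. by case: z. Qed.
Lemma reM z w : re (z * w) = re z * re w - im z * im w.
Proof. by case: z w => [? ?] []. Qed.
Lemma imM z w : im (z * w) = re z * im w + im z * re w.
Proof. by case: z w => [? ?] []. Qed.
Lemma re_real (r : R) : re (realC r) = r. Proof. by []. Qed.
Lemma im_real (r : R) : im (realC r) = 0. Proof. by []. Qed.
Lemma re_conj z : re z^* = re z. Proof. by case: z. Qed.
Lemma im_conj z : im z^* = - im z. Proof. by case: z. Qed.

Lemma reim_eq z w : re z = re w -> im z = im w -> z = w.
Proof. by case: z w => [a b] [c d] /= -> ->. Qed.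

HB.instance Definition _ := GRing.isAdditive.Build C R re
  (fun z w => etrans (reD z (- w)) (congr1 _ (reN w))).
HB.instance Definition _ := GRing.isAdditive.Build C R im
  (fun z w => etrans (imD z (- w)) (congr1 _ (imN w))).

Lemma realC_is_additive : additive (@realC R).
Proof. by move=> x y; apply: reim_eq; rewrite ?raddfB //= /im/= subrr. Qed.
Lemma realC_is_multiplicative : multiplicative (@realC R).
Proof.
split=> [x y|//]; apply: reim_eq; rewrite ?reM ?imM /=;
  by rewrite ?mul0r ?mulr0 ?subr0 ?addr0.
Qed.
HB.instance Definition _ :=
  GRing.isAdditive.Build R C (@realC R) realC_is_additive.
HB.instance Definition _ :=
  GRing.isMultiplicative.Build R C (@realC R) realC_is_multiplicative.

Lemma norm_realC (r : R) : `|realC r : C| = realC `|r|.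
Proof. rewrite (normc_def (realC r)) /= expr0n addr0 sqrtr_sqr //. Qed.

Lemma normC_realP z : exists2 r : R, `|z| = realC r & 0 <= r.
Proof.
rewrite (normc_def z); eexists; first by reflexivity.
exact: sqrtr_ge0.
Qed.

Lemma le_realC (r s : R) : (realC r <= realC s) = (r <= s).
Proof. exact: lecR. Qed.
Lemma lt_realC (r s : R) : (realC r < realC s) = (r < s).
Proof. exact: ltcR. Qed.

Lemma ler_re z : realC `|re z| <= `|z|.
Proof. exact: normc_ge_Re. Qed.
Lemma ler_im z : realC `|im z| <= `|z|.
Proof.
rewrite (normc_def z) le_realC -sqrtr_sqr ler_wsqrtr// lerDr sqr_ge0 //.
Qed.

Lemma reim_split z : z = realC (re z) + imagC R * realC (im z).
Proof. by apply: reim_eq; rewrite !(reD,imD,reM,imM) /= /re /im /=; ring. Qed.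

Lemma ler_norm_reim z : `|z| <= realC (`|re z| + `|im z|).
Proof.
rewrite [X in `|X|]reim_split (le_trans (ler_normD _ _))// normrM !norm_realC.
suff -> : `|imagC R| = 1 by rewrite mul1r raddfD.
by rewrite (normc_def (imagC R)) /= expr0n expr1n add0r sqrtr1.
Qed.

Lemma gt0_realC (e : C) : 0 < e -> exists2 r : R, e = realC r & 0 < r.
Proof.
move=> e0; have [r er r0] := normC_realP e.
by exists r; rewrite -?er ?gtr0_norm// -lt_realC -er normr_gt0 gt_eqF.
Qed.

Lemma cvg_reimP (T : Type) (F : set_system T) {FF : Filter F} (f : T -> C) l :
  f @ F --> l <->
  (re \o f @ F --> re l) /\ (im \o f @ F --> im l).
Proof.
split=> [fl|[rl il]].
  split; apply/cvgrPdist_lt => e e0; move/cvgrPdist_lt: fl => /(_ (realC e)).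
    rewrite (lt_realC 0) => /(_ e0); apply: filterS => x xe.
    by rewrite -lt_realC (le_lt_trans _ xe)//= -raddfB ler_re.
  rewrite (lt_realC 0) => /(_ e0); apply: filterS => x xe.
  by rewrite -lt_realC (le_lt_trans _ xe)//= -raddfB ler_im.
apply/cvgrPdist_lt => e /gt0_realC[r -> r0].
have r20 : 0 < r / 2 by rewrite divr_gt0.
move/cvgrPdist_lt: rl => /(_ _ r20) rl; move/cvgrPdist_lt: il => /(_ _ r20) il.
apply: filterS2 rl il => x /= rx ix; apply: le_lt_trans (ler_norm_reim _) _.
by rewrite lt_realC !raddfB/= [r]splitr ltrD.
Qed.

End ReIm.

Arguments re {R} z.
Arguments im {R} z.
Arguments realC {R} r.

Section MatrixLimits.
Variable K : numFieldType.

Lemma cvg_mxP m n (T : Type) (F : set_system T) {FF : Filter F}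
    (f : T -> 'M[K]_(m, n)) (l : 'M[K]_(m, n)) :
  f @ F --> l <-> forall i j, (fun x => f x i j) @ F --> l i j.
Proof.
split=> [fl i j|fl A].
  exact: (cvg_comp f (fun M : 'M[K]_(m, n) => M i j) fl
    (@coord_continuous K m n i j l)).
move=> [P Pl PA]; apply: (filterS (P := fun x => forall i j, P i j (f x i j))).
  by move=> x ?; exact: PA.
by apply: filter_forall => i; apply: filter_forall => j; exact: (fl i j _ (Pl i j)).
Qed.

Lemma cvg_bigsum (I T : Type) (F : set_system T) {FF : Filter F} (s : seq I)
    (f : I -> T -> K) (l : I -> K) :
  (forall i, f i @ F --> l i) ->
  (fun x => \sum_(i <- s) f i x) @ F --> \sum_(i <- s) l i.
Proof.
move=> fl; elim: s => [|i s IH].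
  rewrite big_nil (_ : (fun x => _) = fun=> 0); first exact: cvg_cst.
  by apply/funext => x; rewrite big_nil.
rewrite big_cons (_ : (fun x => _) = fun x => f i x + \sum_(j <- s) f j x).
  exact: cvgD (fl i) IH.
by apply/funext => x; rewrite big_cons.
Qed.

Lemma cvg_mulmx m n p (T : Type) (F : set_system T) {FF : Filter F}
    (f : T -> 'M[K]_(m, n)) (g : T -> 'M[K]_(n, p))
    (l : 'M[K]_(m, n)) (k : 'M[K]_(n, p)) :
  f @ F --> l -> g @ F --> k -> (fun x => f x *m g x) @ F --> l *m k.
Proof.
move=> /cvg_mxP fl /cvg_mxP gk; apply/cvg_mxP => i j; rewrite mxE.
under eq_fun do rewrite mxE.
by apply: cvg_bigsum => a; exact: cvgM (fl i a) (gk a j).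
Qed.

End MatrixLimits.

Section Derivatives.
Variable R : realType.
Local Notation C := (Cplx R).

Lemma has_deriv_mxP m n (f : R -> 'M[C]_(m, n)) t l :
  has_deriv realC f t l <->
  forall i j, has_deriv realC (fun s => f s i j : C) t (l i j).
Proof.
have E i j : (fun h => diff_quot realC f t h i j) =
    diff_quot realC (fun s => f s i j : C) t.
  by apply/funext => h; rewrite /diff_quot !mxE.
by rewrite /has_deriv cvg_mxP; split=> fl i j; have := fl i j; rewrite E.
Qed.

Lemma is_deriveP (f : R -> R) (t l : R) :
  is_derive t (1 : R) f l <->
  (fun h => h^-1 * (f (t + h) - f t)) @ (0 : R)^' --> l.
Proof.
have E : (fun h : R => h^-1 *: (f (h *: 1 + t) - f t)) =
         (fun h => h^-1 * (f (t + h) - f t)).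
  by apply/funext => h; rewrite [h *: 1]mulr1 (addrC h).
split=> [[df <-]|fl].
  move: df; rewrite /derivable /derive /= E.
  done.
split; last by rewrite /derive /= E; apply: cvg_lim fl.
by rewrite /derivable E; apply/cvg_ex; exists l.
Qed.

(** The bridge to real analysis: through the real and imaginary parts of entries, the chain rule and
    the mean value theorem for real functions become available for matrix curves. *)
Lemma has_deriv_reimP (f : R -> C) t (l : C) :
  has_deriv realC f t l <->
  is_derive t (1 : R) (fun s => re (f s)) (re l) /\
  is_derive t (1 : R) (fun s => im (f s)) (im l).
Proof.
have V (h : R) : (realC h)^-1 = realC h^-1 by rewrite fmorphV.
rewrite /has_deriv cvg_reimP !is_deriveP.
have -> : re \o diff_quot realC (f : R -> C) t =
    (fun h => h^-1 * (re (f (t + h)) - re (f t))).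
  by apply/funext => h /=; rewrite /diff_quot V reM /= mul0r subr0 raddfB.
suff -> : im \o diff_quot realC (f : R -> C) t =
    (fun h => h^-1 * (im (f (t + h)) - im (f t))) by [].
by apply/funext => h /=; rewrite /diff_quot V imM /= mul0r addr0 raddfB.
Qed.

Lemma continuous_reim_mxP (T : topologicalType) m n (f : T -> 'M[C]_(m, n)) t :
  {for t, continuous f} <->
  forall i j, {for t, continuous (fun s => re (f s i j))} /\
              {for t, continuous (fun s => im (f s i j))}.
Proof.
rewrite /prop_for /continuous_at cvg_mxP.
by split=> fc i j; move: (fc i j); rewrite cvg_reimP.
Qed.

Lemma has_deriv_continuous m n (f : R -> 'M[C]_(m, n)) t l :
  has_deriv realC f t l -> {for t, continuous f}.
Proof.
move=> /has_deriv_mxP fl; apply/continuous_reim_mxP => i j.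
have /has_deriv_reimP[[dr _] [di _]] := fl i j.
by split; apply: differentiable_continuous; apply/derivable1_diffP.
Qed.

Lemma has_deriv_unique m n (f : R -> 'M[C]_(m, n)) t l l' :
  has_deriv realC f t l -> has_deriv realC f t l' -> l = l'.
Proof.
move=> /has_deriv_mxP fl /has_deriv_mxP fl'; apply/matrixP => i j.
have /has_deriv_reimP[[_ rl] [_ il]] := fl i j.
have /has_deriv_reimP[[_ rl'] [_ il']] := fl' i j.
by apply: reim_eq; [rewrite -rl -rl' | rewrite -il -il'].
Qed.

Lemma has_deriv_cst m n (A : 'M[C]_(m, n)) t : has_deriv realC (fun=> A) t 0.
Proof.
rewrite /has_deriv (_ : diff_quot _ _ _ = fun=> 0); first exact: cvg_cst.
by apply/funext => h; rewrite /diff_quot subrr scaler0.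
Qed.

Lemma has_derivM m n p (f : R -> 'M[C]_(m, n)) (g : R -> 'M[C]_(n, p)) t f' g' :
  has_deriv realC f t f' -> has_deriv realC g t g' ->
  has_deriv realC (fun s => f s *m g s) t (f' *m g t + f t *m g').
Proof.
move=> df dg; rewrite /has_deriv.
(* The increment is split without exchanging factors; the first term contains [g (t + h)], whence
   the appeal to continuity of [g] at [t]. *)
have -> : diff_quot realC (fun s => f s *m g s) t =
    (fun h => diff_quot realC f t h *m g (t + h) + f t *m diff_quot realC g t h).
  apply/funext => h; rewrite /diff_quot -scalemxAl -scalemxAr -scalerDr.
  by rewrite mulmxBl mulmxBr addrA subrK.
apply: (@cvgD _ 'M[C]_(m, p)); last first.
  have ft : (fun _ : R => f t) @ (0 : R)^' --> f t by exact: cvg_cst.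
  exact: cvg_mulmx ft dg.
apply: cvg_mulmx df _.
have gt : (fun h => g (t + h)) @ (0 : R) --> g t.
  apply: (cvg_comp (fun h => t + h) g); last exact: has_deriv_continuous dg.
  have := @cvgD _ R _ _ _ (fun=> t) id t (0 : R) (cvg_cst _) (@cvg_id _ _).
  by rewrite addr0; exact.
exact: cvg_within_filter gt.
Qed.

Lemma has_deriv_mull m n p (A : 'M[C]_(m, n)) (f : R -> 'M[C]_(n, p)) t f' :
  has_deriv realC f t f' -> has_deriv realC (fun s => A *m f s) t (A *m f').
Proof.
by move=> df; have := has_derivM (has_deriv_cst A t) df; rewrite mul0mx add0r.
Qed.

Lemma has_deriv_mulr m n p (f : R -> 'M[C]_(m, n)) (A : 'M[C]_(n, p)) t f' :
  has_deriv realC f t f' -> has_deriv realC (fun s => f s *m A) t (f' *m A).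
Proof.
by move=> df; have := has_derivM df (has_deriv_cst A t); rewrite mulmx0 addr0.
Qed.

Lemma has_deriv_adj m n (f : R -> 'M[C]_(m, n)) t f' :
  has_deriv realC f t f' -> has_deriv realC (fun s => (f s)^t*) t (f'^t*).
Proof.
move=> /has_deriv_mxP df; apply/has_deriv_mxP => i j.
have /has_deriv_reimP[dr di] := df j i.
apply/has_deriv_reimP; rewrite !mxE.
have -> : (fun s => re (((f s)^t*) i j)) = (fun s => re (f s j i)).
  by apply/funext => s; rewrite !mxE re_conj.
have -> : (fun s => im (((f s)^t*) i j)) = - (fun s => im (f s j i)).
  by apply/funext => s; rewrite !mxE im_conj.
by rewrite re_conj im_conj; split => //; exact: is_deriveN.
Qed.

Lemma has_deriv_affine m n (f : R -> 'M[C]_(m, n)) (a b t : R) f' :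
  has_deriv realC f (a * t + b) f' ->
  has_deriv realC (fun s => f (a * s + b)) t (realC a *: f').
Proof.
move=> /has_deriv_mxP df; apply/has_deriv_mxP => i j.
have /has_deriv_reimP[dr di] := df i j.
have dab : is_derive t (1 : R) (fun s => a * s + b) a.
  apply/is_derive1_caratheodory; exists (fun=> a); split=> // [z|].
    by ring.
  exact: cvg_cst.
apply/has_deriv_reimP; rewrite mxE reM imM re_real im_real !mul0r subr0 addr0.
split.
  rewrite mulrC; exact: (@is_derive1_comp R (fun s => re (f s i j)) _ t _ _ dr dab).
rewrite mulrC; exact: (@is_derive1_comp R (fun s => im (f s i j)) _ t _ _ di dab).
Qed.

Lemma has_derivZ m n (f : R -> R) (A : 'M[C]_(m, n)) t (f' : R) :
  is_derive t (1 : R) f f' ->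
  has_deriv realC (fun s => realC (f s) *: A) t (realC f' *: A).
Proof.
move=> df; apply/has_deriv_mxP => i j; apply/has_deriv_reimP.
rewrite !mxE reM imM re_real im_real !mul0r subr0 addr0.
have -> : (fun s => re ((realC (f s) *: A) i j)) = re (A i j) \*: f.
  by apply/funext => s; rewrite mxE reM re_real im_real mul0r subr0 mulrC.
have -> : (fun s => im ((realC (f s) *: A) i j)) = im (A i j) \*: f.
  by apply/funext => s; rewrite mxE imM re_real im_real mul0r addr0 mulrC.
by split; rewrite mulrC; exact: is_deriveZ.
Qed.

Lemma has_derivD m n (f g : R -> 'M[C]_(m, n)) t f' g' :
  has_deriv realC f t f' -> has_deriv realC g t g' ->
  has_deriv realC (fun s => f s + g s) t (f' + g').
Proof.
move=> df dg; rewrite /has_deriv.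
have -> : diff_quot realC (fun s => f s + g s) t =
    (fun h => diff_quot realC f t h + diff_quot realC g t h).
  by apply/funext => h; rewrite /diff_quot -scalerDr opprD addrACA.
exact: (@cvgD _ 'M[C]_(m, n)) df dg.
Qed.

End Derivatives.

(** * Strict differentiability and local surjectivity *)

Section L1Norm.
Variable R : realType.
Local Notation C := (Cplx R).

(* The library norm of 'M[Cplx R]_(m, n) is complex-valued and is not
   submultiplicative. *)
Definition l1norm m n (Z : 'M[C]_(m, n)) : R :=
  \sum_i \sum_j (`|re (Z i j)| + `|im (Z i j)|).

Lemma l1norm_ge0 m n (Z : 'M[C]_(m, n)) : 0 <= l1norm Z.
Proof. by apply: sumr_ge0 => i _; apply: sumr_ge0 => j _; rewrite addr_ge0. Qed.

Lemma l1norm0 m n : l1norm (0 : 'M[C]_(m, n)) = 0.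
Proof.
by apply: big1 => i _; apply: big1 => j _; rewrite mxE !raddf0 normr0 addr0.
Qed.

Lemma l1normN m n (Z : 'M[C]_(m, n)) : l1norm (- Z) = l1norm Z.
Proof.
by apply: eq_bigr => i _; apply: eq_bigr => j _; rewrite mxE reN imN !normrN.
Qed.

Lemma ler_l1normD m n (Y Z : 'M[C]_(m, n)) :
  l1norm (Y + Z) <= l1norm Y + l1norm Z.
Proof.
rewrite -big_split; apply: ler_sum => i _; rewrite -big_split.
by apply: ler_sum => j _; rewrite mxE reD imD /= addrACA lerD// ler_normD.
Qed.

Lemma l1normZ m n (r : R) (Z : 'M[C]_(m, n)) :
  l1norm (realC r *: Z) = `|r| * l1norm Z.
Proof.
rewrite mulr_sumr; apply: eq_bigr => i _; rewrite mulr_sumr.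
apply: eq_bigr => j _; rewrite mxE reM imM re_real im_real !mul0r subr0 addr0.
by rewrite !normrM mulrDr.
Qed.

Lemma l1norm_adj m n (Z : 'M[C]_(m, n)) : l1norm (Z^t*) = l1norm Z.
Proof.
rewrite /l1norm exchange_big; apply: eq_bigr => i _; apply: eq_bigr => j _.
by rewrite !mxE re_conj im_conj normrN.
Qed.

Lemma l1norm_entry m n (Z : 'M[C]_(m, n)) i j :
  `|re (Z i j)| + `|im (Z i j)| <= l1norm Z.
Proof.
rewrite /l1norm (bigD1 i)//= (bigD1 j)//= -addrA lerDl addr_ge0//.
  by apply: sumr_ge0 => k _; rewrite addr_ge0.
by apply: sumr_ge0 => k _; apply: sumr_ge0 => l _; rewrite addr_ge0.
Qed.

Lemma l1norm_eq0 m n (Z : 'M[C]_(m, n)) : l1norm Z <= 0 -> Z = 0.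
Proof.
move=> Z0; apply/matrixP => i j; rewrite mxE.
have := le_trans (l1norm_entry Z i j) Z0.
have := normr_ge0 (re (Z i j)); have := normr_ge0 (im (Z i j)) => i0 r0 h.
by apply: reim_eq; apply: normr0_eq0; apply/eqP; rewrite eq_le;
  apply/andP; split; lra.
Qed.

Lemma ler_l1normM m n p (Y : 'M[C]_(m, n)) (Z : 'M[C]_(n, p)) :
  l1norm (Y *m Z) <= l1norm Y * l1norm Z.
Proof.
rewrite mulr_suml; apply: ler_sum => i _.
have rowZ k : \sum_j (`|re (Z k j)| + `|im (Z k j)|) <= l1norm Z.
  rewrite /l1norm [leRHS](bigD1 k)//= lerDl.
  by apply: sumr_ge0 => a _; apply: sumr_ge0 => b _; rewrite addr_ge0.
rewrite mulr_suml.
have step k : \sum_j (`|re (Y i k * Z k j)| + `|im (Y i k * Z k j)|) <=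
    (`|re (Y i k)| + `|im (Y i k)|) * l1norm Z.
  apply: le_trans (ler_wpM2l _ (rowZ k)); last by rewrite addr_ge0.
  rewrite mulr_sumr; apply: ler_sum => j _; rewrite reM imM.
  apply: le_trans (lerD (ler_normB _ _) (ler_normD _ _)) _.
  by rewrite !normrM; lra.
apply: le_trans (ler_sum _ (fun k _ => step k)).
rewrite [leRHS]exchange_big; apply: ler_sum => j _; rewrite !mxE !raddf_sum.
by rewrite [leRHS]big_split; apply: lerD; exact: ler_norm_sum.
Qed.

Lemma l1norm_sum m n (I : Type) (s : seq I) (F : I -> 'M[C]_(m, n)) :
  l1norm (\sum_(i <- s) F i) <= \sum_(i <- s) l1norm (F i).
Proof.
elim/big_ind2 : _ => [|X x Y y Xx Yy|//].
  by rewrite l1norm0.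
exact: le_trans (ler_l1normD _ _) (lerD Xx Yy).
Qed.

End L1Norm.

(** * Real coordinates on complex matrices *)

Section Coordinates.
Variable R : realType.
Local Notation C := (Cplx R).
Variable n : nat.

(** A real-linear identification: both the fixed point theorem and the description of real subspaces
    by linear equations are applied to real row vectors. *)
Definition coords (Z : 'M[C]_n) : 'rV[R]_(n * n + n * n) :=
  row_mx (mxvec (map_mx re Z)) (mxvec (map_mx im Z)).

Definition uncoords (v : 'rV[R]_(n * n + n * n)) : 'M[C]_n :=
  map_mx realC (vec_mx (lsubmx v)) + imagC R *: map_mx realC (vec_mx (rsubmx v)).

Lemma coordsK : cancel coords uncoords.
Proof.
move=> Z; rewrite /uncoords /coords row_mxKl row_mxKr !mxvecK.
by apply/matrixP => i j; rewrite !mxE -reim_split.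
Qed.

Lemma uncoordsK : cancel uncoords coords.
Proof.
move=> v; rewrite -[RHS]hsubmxK /coords.
suff [-> ->] : map_mx re (uncoords v) = vec_mx (lsubmx v) /\
    map_mx im (uncoords v) = vec_mx (rsubmx v) by rewrite !vec_mxK.
by split; apply/matrixP => i j; rewrite !mxE !(reD,imD,reM,imM) /=
  /re /im /=; ring.
Qed.

Lemma coordsB Y Z : coords (Y - Z) = coords Y - coords Z.
Proof. by rewrite /coords !map_mxB !linearB/= opp_row_mx add_row_mx. Qed.

Lemma coordsD Y Z : coords (Y + Z) = coords Y + coords Z.
Proof. by rewrite /coords !map_mxD !linearD/= add_row_mx. Qed.

Lemma coordsZ (r : R) Z : coords (realC r *: Z) = r *: coords Z.
Proof.
rewrite /coords scale_row_mx -!linearZ; congr (row_mx (mxvec _) (mxvec _)).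
  by apply/matrixP => i j; rewrite !mxE reM /= mul0r subr0.
by apply/matrixP => i j; rewrite !mxE imM /= mul0r addr0.
Qed.

Lemma uncoordsD u v : uncoords (u + v) = uncoords u + uncoords v.
Proof.
by rewrite -[in LHS](uncoordsK u) -[in LHS](uncoordsK v) -coordsD coordsK.
Qed.

Lemma uncoordsB u v : uncoords (u - v) = uncoords u - uncoords v.
Proof.
by rewrite -[in LHS](uncoordsK u) -[in LHS](uncoordsK v) -coordsB coordsK.
Qed.

Lemma uncoordsZ r v : uncoords (r *: v) = realC r *: uncoords v.
Proof. by rewrite -[in LHS](uncoordsK v) -coordsZ coordsK. Qed.

HB.instance Definition _ := GRing.isAdditive.Build _ _ uncoords uncoordsB.

Lemma uncoords_sum_delta v :
  uncoords v = \sum_k realC (v 0 k) *: uncoords (delta_mx 0 k).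
Proof.
rewrite [in LHS](row_sum_delta v) raddf_sum.
by apply: eq_bigr => k _ /=; rewrite uncoordsZ.
Qed.

Lemma ler_norm_row m (v : 'rV[R]_m) k : `|v 0 k| <= `|v|.
Proof.
rewrite [leRHS]/Num.Def.normr/= mx_normrE.
exact: (le_bigmax _ (fun i : 'I_1 * 'I_m => `|v i.1 i.2|) (0, k)).
Qed.

Lemma norm_row_le m (v : 'rV[R]_m) e :
  0 <= e -> (forall k, `|v 0 k| <= e) -> `|v| <= e.
Proof.
move=> e0 ve; rewrite [leLHS]/Num.Def.normr/= mx_normrE; apply/bigmax_leP.
by split=> // -[i k] _; rewrite (ord1 i).
Qed.

Lemma norm_coords Z : `|coords Z| <= l1norm Z.
Proof.
apply: norm_row_le => [|k]; first exact: l1norm_ge0.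
rewrite mxE; case: splitP => l _; case/mxvec_indexP: l => i j;
  rewrite mxvecE mxE; apply: le_trans (l1norm_entry Z i j).
  by rewrite lerDl.
by rewrite lerDr.
Qed.

Lemma l1norm_uncoords_bound :
  exists2 K : R, 0 <= K & forall v, l1norm (uncoords v) <= K * `|v|.
Proof.
exists (\sum_k l1norm (uncoords (delta_mx 0 k))).
  by apply: sumr_ge0 => k _; exact: l1norm_ge0.
move=> v; rewrite uncoords_sum_delta mulr_suml.
apply: le_trans (l1norm_sum _ _) _; apply: ler_sum => k _.
by rewrite l1normZ mulrC ler_wpM2l ?l1norm_ge0 ?ler_norm_row.
Qed.

End Coordinates.

Section StrictDifferentiability.
Variable R : realType.
Local Notation C := (Cplx R).
Variables m n : nat.
Implicit Types (f g L M : 'rV[R]_m -> 'M[C]_n).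

(** Strict differentiability at the origin with derivative [L]: the difference of [f] and [L] has
    arbitrarily small Lipschitz constant on small balls. Comparing two arbitrary points, rather than
    a point with the origin, is what later yields a contraction. *)
Definition strict_diff f L := forall e : R, 0 < e -> \forall d \near 0^'+,
  forall u v, `|u| <= d -> `|v| <= d ->
    l1norm (f u - f v - (L u - L v)) <= e * `|u - v|.

Definition klip (K : R) L := forall u v, l1norm (L u - L v) <= K * `|u - v|.

Lemma strict_diff_lip f L K : strict_diff f L -> klip K L ->
  \forall d \near 0^'+, forall u v, `|u| <= d -> `|v| <= d ->
    l1norm (f u - f v) <= (K + 1) * `|u - v|.
Proof.
move=> /(_ 1 ltr01) fL LK; apply: filterS fL => d fL u v ud vd.
rewrite -[f u - f v](subrK (L u - L v)) (le_trans (ler_l1normD _ _))//.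
by rewrite addrC mulrDl lerD ?LK ?fL.
Qed.

(** The product rule at a point where both factors equal 1, so that the two derivatives simply add
    up. *)
Lemma strict_diffM f g L M K K' : 0 <= K -> 0 <= K' ->
  f 0 = 1%:M -> g 0 = 1%:M ->
  klip K L -> klip K' M -> strict_diff f L -> strict_diff g M ->
  strict_diff (fun v => f v *m g v) (fun v => L v + M v).
Proof.
move=> K0 K'0 f0 g0 LK MK' fL gM e e0.
(* [c] will bound [l1norm (g u)], since [g u] stays within distance 1 of the identity. *)
set c := l1norm (1%:M : 'M[C]_n) + 1.
have c0 : 0 < c by rewrite ltr_wpDl ?l1norm_ge0.
have e1 : 0 < e / 4 / c by rewrite !divr_gt0.
have e2 : 0 < e / 4 by rewrite divr_gt0.
near=> d.
have d0 : 0 < d by near: d; exact: nbhs_right_gt.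
have [fLd gMd fd gd] : [/\ 
  forall u v, `|u| <= d -> `|v| <= d ->
    l1norm (f u - f v - (L u - L v)) <= e / 4 / c * `|u - v|,
  forall u v, `|u| <= d -> `|v| <= d ->
    l1norm (g u - g v - (M u - M v)) <= e / 4 * `|u - v|,
  forall u v, `|u| <= d -> `|v| <= d ->
    l1norm (f u - f v) <= (K + 1) * `|u - v| &
  forall u v, `|u| <= d -> `|v| <= d ->
    l1norm (g u - g v) <= (K' + 1) * `|u - v| ].
  split; near: d; [exact: fL|exact: gM|exact: strict_diff_lip fL LK|
                   exact: strict_diff_lip gM MK'].
have KKd : (K + 1) * ((K' + 1) * d) <= e / 4.
  rewrite mulrA mulrC -ler_pdivlMr; last by nra.
  near: d; apply: nbhs_right_le; apply: divr_gt0 => //; nra.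
have Kd : (K' + 1) * d <= 1.
  rewrite mulrC -ler_pdivlMr; last by lra.
  near: d; apply: nbhs_right_le; apply: divr_gt0 => //; lra.
move=> u v ud vd; set w := `|u - v|.
have w0 : 0 <= w by exact: normr_ge0.
have z0 : `|0 : 'rV[R]_m| <= d by rewrite normr0 ltW.
have gu1 : l1norm (g u - 1%:M) <= (K' + 1) * d.
  rewrite -g0 (le_trans (gd _ _ ud z0))// subr0 ler_wpM2l//; lra.
have fv1 : l1norm (f v - 1%:M) <= (K + 1) * d.
  rewrite -f0 (le_trans (fd _ _ vd z0))// subr0 ler_wpM2l//; lra.
(* Four error terms, each at most [e / 4 * w]: the two strict differentiability errors, and two
   products of a Lipschitz increment with the small deviation of a factor from 1. *)
have -> : f u *m g u - f v *m g v - (L u + M u - (L v + M v)) =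
  (f u - f v - (L u - L v)) *m g u + (L u - L v) *m (g u - 1%:M) +
  ((f v - 1%:M) *m (g u - g v) + (g u - g v - (M u - M v))).
  rewrite !(mulmxBl, mulmxBr) !(mulmx1, mul1mx).
  by apply/matrixP => i j; rewrite !mxE; ring.
have gu : l1norm (g u) <= c.
  rewrite -[g u](subrK 1%:M) (le_trans (ler_l1normD _ _))// addrC lerD2l.
  exact: le_trans gu1 Kd.
have t1 : l1norm ((f u - f v - (L u - L v)) *m g u) <= e / 4 * w.
  apply: le_trans (ler_l1normM _ _) _.
  apply: le_trans (ler_pM _ _ (fLd _ _ ud vd) gu) _; rewrite ?l1norm_ge0//.
  by rewrite mulrAC divfK ?gt_eqF.
have t2 : l1norm ((L u - L v) *m (g u - 1%:M)) <= e / 4 * w.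
  apply: le_trans (ler_l1normM _ _) _.
  apply: le_trans (ler_pM _ _ (LK u v) gu1) _; rewrite ?l1norm_ge0//.
  rewrite -/w mulrAC ler_wpM2r// (le_trans _ KKd)// ler_wpM2r; nra.
have t3 : l1norm ((f v - 1%:M) *m (g u - g v)) <= e / 4 * w.
  apply: le_trans (ler_l1normM _ _) _.
  apply: le_trans (ler_pM _ _ fv1 (gd _ _ ud vd)) _; rewrite ?l1norm_ge0//.
  by rewrite -/w mulrA ler_wpM2r// (le_trans _ KKd)// mulrAC mulrA.
have t4 := gMd _ _ ud vd.
apply: le_trans (ler_l1normD _ _) _.
apply: le_trans (lerD (ler_l1normD _ _) (ler_l1normD _ _)) _.
apply: le_trans (lerD (lerD t1 t2) (lerD t3 t4)) _.
by rewrite -/w -!mulrDl ler_wpM2r//; lra.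
Unshelve. all: by end_near. Qed.

End StrictDifferentiability.

(* Banach's theorem needs the join of completeness with the normed module. *)
HB.instance Definition _ (R : realType) m n :=
  Uniform_isComplete.Build 'M[R]_(m, n) (@cauchy_cvg 'M[R]_(m, n)).

Section LocalSurjectivity.
Variable R : realType.
Local Notation C := (Cplx R).

(** The surjective half of the inverse function theorem, for a map whose derivative at 0 is the
    identity in real coordinates. *)
Lemma strict_diff_local_surj n (F : 'rV[R]_(n * n + n * n) -> 'M[C]_n) :
  F 0 = 1%:M -> strict_diff F (@uncoords R n) -> forall r0 : R, 0 < r0 ->
  \forall d \near 0^'+, forall Y, l1norm (Y - 1%:M) <= d ->
    exists2 v, `|v| <= r0 & F v = Y.
Proof.
move=> F0 dF r0 r00.
near (0 : R)^'+ => r.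
have r_gt0 : 0 < r by near: r; exact: nbhs_right_gt.
have rr0 : r <= r0 by near: r; exact: nbhs_right_le.
have Fr : forall u v, `|u| <= r -> `|v| <= r ->
    l1norm (F u - F v - (uncoords u - uncoords v)) <= 2^-1 * `|u - v|.
  by near: r; apply: dF; rewrite invr_gt0.
near=> d => Y Yd.
(* With contraction factor 1/2, a displacement of the centre by at most [r / 2] keeps the ball of
   radius [r] stable under [T]. *)
have dr : d <= r / 2 by near: d; apply: nbhs_right_le; rewrite divr_gt0.
pose U : set 'rV[R]_(n * n + n * n) := [set v | `|v| <= r].
(* Newton's iteration with the derivative frozen at 0; its fixed points are the solutions of
   [F v = Y]. *)
pose T v : 'rV[R]_(n * n + n * n) := v - coords (F v - Y).
have TE u v : T u - T v = - coords (F u - F v - (uncoords u - uncoords v)).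
  rewrite -uncoordsB [coords (_ - _)]coordsB uncoordsK coordsB /T !coordsB.
  by apply/rowP => i; rewrite !mxE; ring.
have Tlip u v : `|u| <= r -> `|v| <= r -> `|T u - T v| <= 2^-1 * `|u - v|.
  by move=> ur vr; rewrite TE normrN (le_trans (norm_coords _))// Fr.
have TU : set_fun U U T.
  move=> v /= vr; rewrite /U /= -[T v](subrK (T 0)) (le_trans (ler_normD _ _))//.
  have : `|T v - T 0| <= 2^-1 * `|v - 0| by apply: Tlip => //; rewrite normr0 ltW.
  have : `|T 0| <= r / 2.
    rewrite /T sub0r normrN F0 (le_trans (norm_coords _))//.
    by rewrite -l1normN opprB (le_trans Yd).
  have vr' : `|v| <= r := vr.
  rewrite subr0 => h1 h2; lra.
have [|||v Uv Tv] := @banach_fixed_point R _ U (mkfun_fun TU).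
- exists (2^-1)%:nng; split; first by rewrite /= invf_lt1// ltr1n.
  by move=> [u v] /= [ur vr]; exact: Tlip.
- rewrite (_ : U = (fun v => `|v|) @^-1` [set x | x <= r]) //.
  by apply: closed_comp; [move=> v _; exact: norm_continuous | exact: closed_le].
- by exists 0; rewrite /U /= normr0 ltW.
exists v; first exact: le_trans Uv rr0.
have /(congr1 (@uncoords R n)) : coords (F v - Y) = 0.
  by apply/oppr_inj/(addrI v); rewrite oppr0 addr0; exact: esym Tv.
by rewrite coordsK raddf0 => /eqP; rewrite subr_eq0 => /eqP.
Unshelve. all: by end_near. Qed.

(** By the mean value theorem the error is the increment [s - t] times the deviation of [h'] from
    [h' 0] at an intermediate point, which continuity of [h'] at 0 makes small. *)
Lemma real_strict_diff (h h' : R -> R) :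
  (forall t, is_derive t (1 : R) h (h' t)) -> {for 0, continuous h'} ->
  forall e : R, 0 < e -> \forall d \near 0^'+, forall s t,
    `|s| <= d -> `|t| <= d -> `|h s - h t - h' 0 * (s - t)| <= e * `|s - t|.
Proof.
move=> dh ch' e e0.
have /cvgrPdist_le/(_ e e0)/nbhs_ballP[d0 /= d00 hd0] := ch'.
near=> d.
have dd0 : d < d0 by near: d; exact: nbhs_right_lt.
have main s t : s <= t -> `|s| <= d -> `|t| <= d ->
    `|h t - h s - h' 0 * (t - s)| <= e * `|t - s|.
  move=> st sd td.
  have [|c /andP[/= sc ct] ->] := @MVT_segment R h h' s t st.
    apply: continuous_subspaceT => x; apply: differentiable_continuous.
    by apply/derivable1_diffP; have [] := dh x.
  rewrite -mulrBl normrM ler_wpM2r// -normrN opprB.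
  apply: hd0; rewrite /ball /= sub0r normrN (le_lt_trans _ dd0)//.
  move: sc ct sd td; rewrite !bnd_simp !ler_norml => sc ct /andP[sd _] /andP[_ td].
  by apply/andP; split; lra.
move=> s t sd td; have [st|/ltW ts] := leP t s; first exact: main.
have -> : h s - h t - h' 0 * (s - t) = - (h t - h s - h' 0 * (t - s)) by ring.
by rewrite normrN (distrC s); exact: main.
Unshelve. all: by end_near. Qed.

Lemma curve_strict_diff n (c c' : R -> 'M[C]_n) :
  (forall t, has_deriv realC c t (c' t)) -> {for 0, continuous c'} ->
  forall e : R, 0 < e -> \forall d \near 0^'+, forall s t,
    `|s| <= d -> `|t| <= d ->
    l1norm (c s - c t - realC (s - t) *: c' 0) <= e * `|s - t|.
Proof.
move=> dc /continuous_reim_mxP cc' e e0.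
(* The error is shared among the [2 n^2] real coordinates; the added 1 keeps the denominator
   positive when [n = 0]. *)
pose e1 := e / ((n * n).*2%:R + 1).
have e10 : 0 < e1 by rewrite divr_gt0// ltr_wpDl.
have H : \forall d \near (0 : R)^'+, forall i j,
   (forall s t, `|s| <= d -> `|t| <= d ->
     `|re (c s i j) - re (c t i j) - re (c' 0 i j) * (s - t)| <= e1 * `|s - t|) /\
   (forall s t, `|s| <= d -> `|t| <= d ->
     `|im (c s i j) - im (c t i j) - im (c' 0 i j) * (s - t)| <= e1 * `|s - t|).
  apply: filter_forall => i; apply: filter_forall => j.
  have [cr ci] := cc' i j.
  have dij t : is_derive t (1 : R) (fun s => re (c s i j)) (re (c' t i j)) /\
               is_derive t (1 : R) (fun s => im (c s i j)) (im (c' t i j)).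
    by apply/has_deriv_reimP; move: (dc t) => /has_deriv_mxP; exact.
  apply: filterI.
    by apply: (real_strict_diff _ cr) => // t; have [] := dij t.
  by apply: (real_strict_diff _ ci) => // t; have [] := dij t.
apply: filterS H => d H s t sd td.
apply: (@le_trans _ _ (\sum_(i < n) \sum_(j < n) (e1 * `|s - t| *+ 2))).
  apply: ler_sum => i _; apply: ler_sum => j _; have [Hr Hi] := H i j.
  rewrite mulr2n; apply: lerD.
    apply: le_trans (Hr s t sd td).
    by rewrite !mxE raddfB raddfB/= reM re_real im_real mul0r subr0 mulrC.
  apply: le_trans (Hi s t sd td).
  by rewrite !mxE raddfB raddfB/= imM re_real im_real mul0r addr0 mulrC.
rewrite !sumr_const !card_ord -!mulrnA -mulr_natr mulrAC ler_wpM2r// mul2n.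
by rewrite /e1 mulrAC ler_pdivrMr ?ltr_wpDl// ler_wpM2l// ?lerDl// ltW.
Qed.

End LocalSurjectivity.

(** * Subgroups of the unitary group with full Lie algebra *)

Section UnitaryNeighbourhood.
Variable R : realType.
Local Notation C := (Cplx R).
Variable n : nat.
Implicit Types X Y Z : 'M[C]_n.

Lemma ctrmxD m p (A B : 'M[C]_(m, p)) : (A + B)^t* = A^t* + B^t*.
Proof. by rewrite linearD /= map_mxD. Qed.

Lemma ctrmxN m p (A : 'M[C]_(m, p)) : (- A)^t* = - A^t*.
Proof. by rewrite linearN /= map_mxN. Qed.

Lemma ctrmxZ m p a (A : 'M[C]_(m, p)) : (a *: A)^t* = a^* *: A^t*.
Proof. by rewrite linearZ /= map_mxZ. Qed.

Lemma ctrmxM m p q (A : 'M[C]_(m, p)) (B : 'M[C]_(p, q)) :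
  (A *m B)^t* = B^t* *m A^t*.
Proof. by rewrite trmx_mul map_mxM. Qed.

Lemma ctrmx1 m : (1%:M : 'M[C]_m)^t* = 1%:M.
Proof. by rewrite trmx1 map_mx1. Qed.

Lemma conj_realC (r : R) : (realC r : C)^* = realC r.
Proof. by apply: reim_eq; rewrite ?re_conj ?im_conj ?im_real ?oppr0. Qed.

Definition skew_part Z : 'M[C]_n := realC 2^-1 *: (Z - Z^t*).
Definition herm_part Z : 'M[C]_n := realC 2^-1 *: (Z + Z^t*).

Lemma skew_herm_part Z : skew_part Z + herm_part Z = Z.
Proof.
rewrite -scalerDr addrCA subrK -mulr2n -[Z *+ 2](@scaler_nat C) scalerA.
by rewrite -(rmorph_nat (@realC R)) -rmorphM mulVf ?pnatr_eq0// scale1r.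
Qed.

Lemma skew_part_adj Z : (skew_part Z)^t* = - skew_part Z.
Proof.
by rewrite ctrmxZ ctrmxD ctrmxN trmxCK conj_realC -scalerN opprB addrC.
Qed.

Lemma herm_part_adj Z : (herm_part Z)^t* = herm_part Z.
Proof. by rewrite ctrmxZ ctrmxD trmxCK conj_realC addrC. Qed.

Lemma herm_partB Y Z : herm_part (Y - Z) = herm_part Y - herm_part Z.
Proof. by rewrite /herm_part ctrmxD ctrmxN -scalerBr opprD addrACA. Qed.

Lemma skew_partD Y Z : skew_part (Y + Z) = skew_part Y + skew_part Z.
Proof. by rewrite /skew_part ctrmxD -scalerDr opprD addrACA. Qed.

Lemma skew_partZ (r : R) Z : skew_part (realC r *: Z) = realC r *: skew_part Z.
Proof. by rewrite /skew_part ctrmxZ conj_realC -scalerBr !scalerA mulrC. Qed.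

Lemma herm_part0 : herm_part 0 = 0.
Proof. by rewrite -[0 in LHS](subrr 0) herm_partB subrr. Qed.

Lemma skew_part0 : skew_part 0 = 0.
Proof. by have := skew_partZ 0 0; rewrite raddf0 !scale0r. Qed.

Lemma l1norm_herm_part Z : l1norm (herm_part Z) <= l1norm Z.
Proof.
rewrite l1normZ ger0_norm ?invr_ge0// ler_pdivrMl//.
by rewrite (le_trans (ler_l1normD _ _))// l1norm_adj mulrDl mul1r.
Qed.

Lemma strict_diff_curve_coord m (k : 'I_m) (c c' : R -> 'M[C]_n) :
  (forall t, has_deriv realC c t (c' t)) -> {for 0, continuous c'} ->
  strict_diff (fun v : 'rV[R]_m => c (v 0 k)) (fun v => realC (v 0 k) *: c' 0).
Proof.
move=> dc cc' e e0; apply: filterS (curve_strict_diff dc cc' e0) => d H u v ud vd.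
rewrite -scalerBl -raddfB.
apply: le_trans (H _ _ (le_trans (ler_norm_row _ _) ud)
                       (le_trans (ler_norm_row _ _) vd)) _.
rewrite ler_wpM2l ?(ltW e0)//.
by have := ler_norm_row (u - v) k; rewrite !mxE.
Qed.

(** Induction on [s] with the product rule; the Lipschitz bound on the derivative is carried along
    because that rule asks for it. *)
Lemma strict_diff_prod_curves m (c c' : 'I_m -> R -> 'M[C]_n) (s : seq 'I_m) :
  (forall k t, has_deriv realC (c k) t (c' k t)) ->
  (forall k, {for 0, continuous (c' k)}) -> (forall k, c k 0 = 1%:M) ->
  let L v := \sum_(k <- s) realC ((v : 'rV[R]_m) 0 k) *: c' k 0 in
  (exists2 K, 0 <= K & klip K L) /\
  strict_diff (fun v => \big[mulmx/1%:M]_(k <- s) c k (v 0 k)) L.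
Proof.
move=> dc cc' c0; elim: s => [|k s [[K K0 LK] dF]] /=.
  split.
    by exists 0 => // u v; rewrite !big_nil subrr l1norm0 mul0r.
  move=> e e0; near=> d => u v _ _.
  by rewrite !big_nil !subrr l1norm0 mulr_ge0// ltW.
have kK : klip (l1norm (c' k 0)) (fun v : 'rV[R]_m => realC (v 0 k) *: c' k 0).
  move=> u v; rewrite -scalerBl -raddfB l1normZ mulrC ler_wpM2l ?l1norm_ge0//.
  by have := ler_norm_row (u - v) k; rewrite !mxE.
have big0 : \big[mulmx/1%:M]_(j <- s) c j ((0 : 'rV[R]_m) 0 j) = 1%:M.
  elim: {dF LK} s => [|j s IH]; first by rewrite big_nil.
  by rewrite big_cons IH mxE c0 mulmx1.
have E v : \sum_(j <- k :: s) realC ((v : 'rV[R]_m) 0 j) *: c' j 0 =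
    realC (v 0 k) *: c' k 0 + \sum_(j <- s) realC (v 0 j) *: c' j 0.
  by rewrite big_cons.
split.
  exists (l1norm (c' k 0) + K); first by rewrite addr_ge0 ?l1norm_ge0.
  move=> u v; rewrite !E opprD addrACA (le_trans (ler_l1normD _ _))// mulrDl.
  by rewrite lerD ?kK ?LK.
move=> e e0.
have f0 : c k ((0 : 'rV[R]_m) 0 k) = 1%:M by rewrite mxE c0.
have H := strict_diffM (l1norm_ge0 (c' k 0)) K0 f0 big0 kK LK
  (strict_diff_curve_coord k (dc k) (cc' k)) dF e0.
apply: filterS H => d H u v ud vd.
by rewrite !big_cons; exact: H.
Unshelve. all: by end_near. Qed.

Lemma unitary_nbhs_sub (G : set 'M[C]_n) :
  G 1%:M -> (forall X Y, G X -> G Y -> G (X *m Y)) ->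
  (forall X, G X -> X \is unitarymx) ->
  (forall X, X^t* = - X -> lie_algebra_of G X) ->
  \forall d \near 0^'+, forall Y, Y \is unitarymx -> l1norm (Y - 1%:M) <= d -> G Y.
Proof.
move=> G1 GM GU GT.
pose m := (n * n + n * n)%N.
(* A redundant spanning family, chosen so that the combination of the [X k] with coefficients [v] is
   exactly the skew-Hermitian part of [uncoords v]. *)
pose X (k : 'I_m) : 'M[C]_n := skew_part (uncoords (delta_mx 0 k)).
have /choice[cc ccP] : forall k, exists cc : (R -> 'M[C]_n) * (R -> 'M[C]_n),
    [/\ forall t, G (cc.1 t), forall t, has_deriv realC cc.1 t (cc.2 t),
        continuous cc.2, cc.1 0 = 1%:M & cc.2 0 = X k].
  by move=> k; have [c [c' ?]] := GT _ (skew_part_adj (uncoords (delta_mx 0 k)));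
     exists (c, c').
pose P (v : 'rV[R]_m) := \big[mulmx/1%:M]_(k <- index_enum 'I_m) (cc k).1 (v 0 k).
pose H (v : 'rV[R]_m) := herm_part (uncoords v).
have [K K0 lipE] := l1norm_uncoords_bound R n.
have lipH : klip K H.
  move=> u v; rewrite /H -herm_partB -uncoordsB.
  exact: le_trans (l1norm_herm_part _) (lipE _).
have dH : strict_diff (fun v => 1%:M + H v) H.
  move=> e e0; near=> d => u v _ _.
  by rewrite opprD addrACA subrr add0r subrr l1norm0 mulr_ge0// ltW.
have [|||[KP KP0 lipP] dP] := @strict_diff_prod_curves m (fun k => (cc k).1)
  (fun k => (cc k).2) (index_enum 'I_m).
- by move=> k; have [] := ccP k.
- by move=> k; have [_ _ cc2 _ _] := ccP k; exact: cc2.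
- by move=> k; have [] := ccP k.
have P0 : P 0 = 1%:M.
  apply: (big_ind (fun Z : 'M[C]_n => Z = 1%:M)) => [//|A B -> ->|k _].
    by rewrite mulmx1.
  by rewrite mxE; have [] := ccP k.
have H0 : 1%:M + H 0 = 1%:M.
  by rewrite /H raddf0 herm_part0 addr0.
(* The curves in [G] account for the skew-Hermitian part and the factor [1 + H v] for the Hermitian
   part; together they restore [uncoords v]. *)
have dF : strict_diff (fun v => P v *m (1%:M + H v)) (@uncoords R n).
  have -> : @uncoords R n = fun v =>
      \sum_(k <- index_enum 'I_m) realC (v 0 k) *: (cc k).2 0 + H v.
    apply/funext => v; rewrite -[LHS]skew_herm_part; congr (_ + _).
    rewrite [in LHS]uncoords_sum_delta.
    rewrite [RHS](eq_bigr (fun k =>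
        skew_part (realC (v 0 k) *: uncoords (delta_mx 0 k)))).
      elim: (index_enum _) => [|k s IH]; last by rewrite !big_cons skew_partD IH.
      by rewrite !big_nil skew_part0.
    by move=> k _; rewrite skew_partZ; have [_ _ _ _ ->] := ccP k.
  exact: strict_diffM KP0 K0 P0 H0 lipP lipH dP dH.
have F0 : P 0 *m (1%:M + H 0) = 1%:M by rewrite P0 H0 mulmx1.
(* This radius ensures [l1norm (H v) <= 1]. *)
have r0 : 0 < (K + 1)^-1 by rewrite invr_gt0 ltr_wpDl.
apply: filterS (strict_diff_local_surj F0 dF r0) => d Hd Y UY Yd.
have [v vr FY] := Hd Y Yd.
have GP : G (P v).
  by apply: big_ind => [|//|k _] //; have [] := ccP k.
suff H_eq0 : H v = 0 by rewrite -FY H_eq0 addr0 mulmx1.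
have U1H : 1%:M + H v \is unitarymx.
  have -> : 1%:M + H v = (P v)^t* *m Y.
    by rewrite -FY -(invmx_unitary (GU _ GP)) mulKmx// unitarymx_unit ?GU.
  by apply: mul_unitarymx UY; rewrite trmxC_unitary; exact: GU _ GP.
(* A Hermitian unitary matrix squares to 1; for [1 + H v] this says that the square of [H v] is
   [-2 H v]. Then twice the norm of [H v] is at most its square, hence at most the norm itself,
   which must vanish. *)
have HH : H v *m H v = - (H v + H v).
  move/unitarymxP: U1H; rewrite ctrmxD ctrmx1 herm_part_adj -/(H v).
  rewrite mulmxDl mul1mx mulmxDr mulmx1 -addrA -[RHS]addr0 => /addrI.
  by rewrite addrA addrC => /eqP; rewrite addr_eq0 => /eqP.
have Hle1 : l1norm (H v) <= 1.
  apply: le_trans (l1norm_herm_part _) _; apply: le_trans (lipE v) _.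
  apply: le_trans (ler_wpM2l K0 vr) _.
  by rewrite ler_pdivrMr ?ltr_wpDl// mul1r lerDl.
apply: l1norm_eq0.
have := ler_l1normM (H v) (H v); rewrite HH l1normN -mulr2n.
have -> : H v *+ 2 = realC 2 *: H v.
  by rewrite (rmorph_nat (@realC R)) scaler_nat.
rewrite l1normZ ger0_norm//; have := l1norm_ge0 (H v); nra.
Unshelve. all: by end_near. Qed.

End UnitaryNeighbourhood.

(** * Complex numbers of modulus 1 *)

Section Phases.
Variable R : realType.
Local Notation C := (Cplx R).

Definition expi (x : R) : C := realC (cos x) + imagC R * realC (sin x).

Lemma re_expi x : re (expi x) = cos x.
Proof. by rewrite /expi reD reM !re_real im_real /re /=; ring. Qed.

Lemma im_expi x : im (expi x) = sin x.
Proof. by rewrite /expi imD imM !im_real re_real /re /im /=; ring. Qed.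

Lemma expiD x y : expi (x + y) = expi x * expi y.
Proof.
apply: reim_eq; rewrite ?reM ?imM !re_expi !im_expi; first exact: cosD.
by rewrite sinD addrC mulrC [in RHS]addrC; ring.
Qed.

Lemma expi0 : expi 0 = 1.
Proof. by apply: reim_eq; rewrite ?re_expi ?im_expi ?cos0 ?sin0. Qed.

Lemma expi_conj x : (expi x)^* = expi (- x).
Proof. by apply: reim_eq; rewrite ?re_conj ?im_conj ?re_expi ?im_expi ?cosN ?sinN. Qed.

Lemma expi_unit x : expi x * (expi x)^* = 1.
Proof. by rewrite expi_conj -expiD subrr expi0. Qed.

Lemma expiX x k : expi x ^+ k = expi (x *+ k).
Proof.
by elim: k => [|k IH]; rewrite ?expr0 ?mulr0n ?expi0// exprS IH mulrS expiD.
Qed.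

Lemma unit_expi (z : C) : z * z^* = 1 -> exists x, z = expi x.
Proof.
move=> zz; have : re z ^+ 2 + im z ^+ 2 = 1.
  by move/(congr1 re): zz; rewrite reM re_conj im_conj mulrN opprK -!expr2.
move: (re z) (im z) (reim_split z) => a b -> ab.
have a1 : -1 <= a <= 1.
  by rewrite -ler_norml -(@ler_sqr _ `|a|) ?nnegrE// real_normK ?num_real// expr1n; nra.
have sa : sin (acos a) = `|b|.
  by rewrite sin_acos// (_ : 1 - a ^+ 2 = b ^+ 2) ?sqrtr_sqr//; lra.
have ca : cos (acos a) = a by apply: acosK; rewrite in_itv.
(* The sine of [acos a] is nonnegative, so a negative imaginary part calls for the opposite
   angle. *)
have [b0|/ltW b0] := leP 0 b.
  by exists (acos a); rewrite /expi ca sa ger0_norm.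
by exists (- acos a); rewrite /expi cosN sinN ca sa ler0_norm// opprK.
Qed.

Lemma cvg_expi (a : R) : expi (s * a) @[s --> 0] --> (1 : C).
Proof.
have sa : s * a @[s --> (0 : R)] --> (0 : R).
  have := @cvgM _ R _ (nbhs_filter (0 : R)) id (fun=> a) 0 a (@cvg_id _ _) (cvg_cst _).
  by rewrite mul0r; exact.
rewrite -expi0; apply/cvg_reimP; split.
  rewrite re_expi (_ : re \o _ = fun s => cos (s * a)).
    exact: (cvg_comp (fun s => s * a) (@cos R) sa (@continuous_cos R 0)).
  by apply/funext => s; exact: re_expi.
rewrite im_expi (_ : im \o _ = fun s => sin (s * a)).
  exact: (cvg_comp (fun s => s * a) (@sin R) sa (@continuous_sin R 0)).
by apply/funext => s; exact: im_expi.
Qed.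

(** Passes from the topology of matrices, in which limits are stated, to estimates in [l1norm]. *)
Lemma l1norm_cvg (T : Type) (F : set_system T) (FF : Filter F) m n
    (f : T -> 'M[C]_(m, n)) (l : 'M[C]_(m, n)) :
  f @ F --> l -> forall e : R, 0 < e -> \forall x \near F, l1norm (f x - l) <= e.
Proof.
move=> /cvg_mxP fl e e0.
pose e1 := e / ((m * n).*2%:R + 1).
have e10 : 0 < e1 by rewrite divr_gt0// ltr_wpDl.
have H : \forall x \near F, forall i j,
    `|re (l i j) - re (f x i j)| <= e1 /\ `|im (l i j) - im (f x i j)| <= e1.
  apply: filter_forall => i; apply: filter_forall => j.
  have /cvg_reimP[/cvgrPdist_le/(_ _ e10) r /cvgrPdist_le/(_ _ e10) i'] := fl i j.
  exact: filterI.
apply: filterS H => x H.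
apply: (@le_trans _ _ (\sum_(i < m) \sum_(j < n) (e1 *+ 2))).
  apply: ler_sum => i _; apply: ler_sum => j _; have [Hr Hi] := H i j.
  by rewrite !mxE !raddfB/= mulr2n lerD// distrC.
rewrite !sumr_const !card_ord -!mulrnA -mulr_natr mul2n [(n * m)%N]mulnC.
by rewrite /e1 mulrAC ler_pdivrMr ?ltr_wpDl// ler_wpM2l// ?lerDl// ltW.
Qed.

End Phases.

(** * Roots of unitary matrices close to the identity *)

Section UnitaryGroup.
Variable R : realType.
Local Notation C := (Cplx R).
Variable n : nat.
Implicit Types X Y Z V W : 'M[C]_n.+1.

Lemma unitary_diag (d : 'rV[C]_n.+1) :
  (diag_mx d \is unitarymx) = [forall j, d 0 j * (d 0 j)^* == 1].
Proof.
apply/unitarymxP/forallP => [dd j|dd].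
  have /matrixP/(_ j j) := dd.
  by rewrite tr_diag_mx map_diag_mx mulmx_diag !mxE eqxx !mulr1n => ->.
rewrite tr_diag_mx map_diag_mx mulmx_diag -diag_const_mx; congr diag_mx.
by apply/rowP => j; rewrite !mxE; exact/eqP.
Qed.

(** Unitary matrices are normal, so the spectral theorem applies. *)
Lemma unitary_diagonalization W : W \is unitarymx ->
  exists P Q d, [/\ P \is @unitarymx C n.+1 n.+1, Q \is @unitarymx C n.+1 n.+1,
    P *m Q = 1%:M, Q *m P = 1%:M & W = Q *m diag_mx d *m P].
Proof.
move=> UW; have nW : W \is normalmx.
  apply/normalmxP; rewrite (unitarymxP UW).
  by rewrite -(invmx_unitary UW) mulVmx// unitarymx_unit.
have UP := spectral_unitarymx W.
exists (spectralmx W); exists ((spectralmx W)^t*); exists (spectral_diag W).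
have PQ : spectralmx W *m (spectralmx W)^t* = 1%:M by exact/unitarymxP.
split; [exact: UP | by rewrite trmxC_unitary | exact: PQ | exact: mulmx1C PQ |].
by rewrite -(invmx_unitary UP); move/orthomx_spectralP: nW.
Qed.

(** In an eigenbasis [W] is diagonal with entries [expi (th j)]; multiplying all angles by [s] gives
    [V s]. *)
Lemma unitary_one_parameter W : W \is unitarymx ->
  exists V : R -> 'M[C]_n.+1,
    [/\ forall s, V s \is unitarymx, V s @[s --> 0] --> (1%:M : 'M[C]_n.+1),
        forall s k, V s ^+ k = V (s *+ k) & V 1 = W].
Proof.
move=> UW; have [P [Q [d [UP UQ PQ QP WE]]]] := unitary_diagonalization UW.
have Ud : diag_mx d \is unitarymx.
  have -> : diag_mx d = P *m W *m Q.
    by rewrite WE !mulmxA PQ mul1mx -mulmxA PQ mulmx1.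
  exact: mul_unitarymx (mul_unitarymx UP UW) UQ.
have /choice[th thP] : forall j, exists x, d 0 j = expi x.
  by move=> j; apply: unit_expi; move: Ud; rewrite unitary_diag => /forallP/(_ j)/eqP.
pose D s : 'M[C]_n.+1 := diag_mx (\row_j expi (s * th j)).
have DM s t : D s *m D t = D (s + t).
  rewrite /D mulmx_diag; congr diag_mx; apply/rowP => j.
  by rewrite !mxE -expiD -mulrDl.
have D0 : D 0 = 1.
  rewrite /D -[RHS]diag_const_mx; congr diag_mx; apply/rowP => j.
  by rewrite !mxE mul0r expi0.
have VM s t : (Q *m D s *m P) *m (Q *m D t *m P) = Q *m D (s + t) *m P.
  by rewrite -DM !mulmxA -(mulmxA _ P Q) PQ mulmx1.
exists (fun s => Q *m D s *m P); split.
- move=> s; apply: mul_unitarymx UP; apply: mul_unitarymx UQ _.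
  rewrite unitary_diag; apply/forallP => j.
  by rewrite !mxE expi_unit.
- rewrite -QP -[Q in X in _ --> X]mulmx1.
  apply: cvg_mulmx; last exact: cvg_cst.
  have cQ : (fun _ : R => Q) @ (0 : R) --> Q by exact: cvg_cst.
  apply: cvg_mulmx cQ _.
  apply/cvg_mxP => i j; rewrite mxE; under eq_fun do rewrite !mxE.
  case: (i == j); rewrite ?mulr1n ?mulr0n; [exact: cvg_expi | exact: cvg_cst].
- move=> s; elim=> [|k IH]; first by rewrite expr0 mulr0n D0 mulmx1 QP.
  by rewrite exprS IH mulrS -VM -mulmxE.
- rewrite [RHS]WE; congr (_ *m _ *m _); congr diag_mx; apply/rowP => j.
  by rewrite mxE mul1r -thP.
Qed.

Lemma unitary_root W (d : R) : W \is unitarymx -> 0 < d ->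
  exists V k, [/\ V \is unitarymx, l1norm (V - 1%:M) <= d & W = V ^+ k].
Proof.
move=> /unitary_one_parameter[V [UV V1 VX <-]] d0.
have /nbhs_ballP[e /= e0 He] := l1norm_cvg (nbhs_filter (0 : R)) V1 d0.
(* The least natural number above [1 / e], so that the parameter [1 / k] falls in the ball of radius
   [e] where [V] is close to 1. *)
pose k := (Num.truncn e^-1).+1.
exists (V k%:R^-1), k; split => //.
  apply: He; rewrite /ball /= sub0r normrN ger0_norm//.
  by rewrite invf_plt ?posrE// truncnS_gt.
by rewrite VX -[_ *+ k]mulr_natr mulVf// pnatr_eq0.
Qed.

Lemma unitary_sub (G : set 'M[C]_n.+1) :
  G 1%:M -> (forall X Y, G X -> G Y -> G (X *m Y)) ->
  (forall X, G X -> X \is unitarymx) ->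
  (forall X, X^t* = - X -> lie_algebra_of G X) ->
  forall W, W \is unitarymx -> G W.
Proof.
move=> G1 GM GU GT W UW.
near (0 : R)^'+ => d.
have d0 : 0 < d by near: d; exact: nbhs_right_gt.
have Gd : forall Y, Y \is unitarymx -> l1norm (Y - 1%:M) <= d -> G Y.
  by near: d; exact: unitary_nbhs_sub.
have [V [k [UV Vd ->]]] := unitary_root UW d0.
have GV := Gd V UV Vd.
by elim: k => [|k IH]; rewrite ?expr0 // exprS; exact: (GM _ _ GV IH).
Unshelve. all: by end_near. Qed.

End UnitaryGroup.

(** * From the unitary group to the special unitary group *)

Section SpecialUnitaryGroup.
Variable R : realType.
Local Notation C := (Cplx R).
Variable n : nat.
Implicit Types X Y Z V W : 'M[C]_n.+1.

Lemma phase_derive (a t : R) :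
  has_deriv realC (fun s => (expi (a * s))%:M : 'M[C]_n.+1) t
    (realC (- a * sin (a * t)) *: 1%:M + realC (a * cos (a * t)) *: (imagC R)%:M).
Proof.
have da : is_derive t (1 : R) (fun s => a * s) a.
  apply/is_derive1_caratheodory; exists (fun=> a); split=> // [z|].
    by ring.
  exact: cvg_cst.
have -> : (fun s => (expi (a * s))%:M : 'M[C]_n.+1) =
  (fun s => realC (cos (a * s)) *: 1%:M + realC (sin (a * s)) *: (imagC R)%:M).
  apply/funext => s; rewrite !scale_scalar_mx.
  by rewrite -raddfD /expi mulr1 [imagC R * _]mulrC.
apply: has_derivD; apply: has_derivZ.
  rewrite mulNr mulrC -mulNr.
  exact: (@is_derive1_comp R cos (fun s => a * s) t _ _ (is_derive_cos _) da).
rewrite mulrC.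
exact: (@is_derive1_comp R sin (fun s => a * s) t _ _ (is_derive_sin _) da).
Qed.

Lemma continuous_realC_scale m p (f : R -> R) (A : 'M[C]_(m, p)) :
  continuous f -> continuous (fun s => realC (f s) *: A).
Proof.
move=> cf s; apply/continuous_reim_mxP => i j; split.
  rewrite (_ : (fun s => _) = (fun s => f s * re (A i j))).
    by apply: cvgM; [exact: cf | exact: cvg_cst].
  by apply/funext => x; rewrite mxE reM re_real im_real mul0r subr0.
rewrite (_ : (fun s => _) = (fun s => f s * im (A i j))).
  by apply: cvgM; [exact: cf | exact: cvg_cst].
by apply/funext => x; rewrite mxE imM re_real im_real mul0r addr0.
Qed.

Lemma SU_sub (G : set 'M[C]_n.+1) :
  G 1%:M -> (forall X Y, G X -> G Y -> G (X *m Y)) -> G `<=` SU R n.+1 ->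
  su R n.+1 `<=` lie_algebra_of G -> SU R n.+1 `<=` G.
Proof.
move=> G1 GM GSU GT.
have GX X k : G X -> G (X ^+ k).
  by move=> GX; elim: k => [|k IH]; rewrite ?expr0// exprS; exact: GM.
(* Phases are adjoined because [unitary_sub] asks for velocities in all skew-Hermitian directions,
   including those of nonzero trace. *)
pose G' : set 'M[C]_n.+1 :=
  [set X | exists x g, G g /\ X = expi x *: g].
have UG' X : X \is unitarymx -> G' X.
  apply: unitary_sub => [|_ _ [x [g [Gg ->]]] [y [h [Gh ->]]]|_ [x [g [Gg ->]]]|Z Zs].
  - by exists 0, 1%:M; rewrite expi0 scale1r.
  - exists (x + y), (g *m h); split; first exact: GM.
    by rewrite -scalemxAl -scalemxAr scalerA expiD.
  - apply/unitarymxP; rewrite ctrmxZ -scalemxAl -scalemxAr scalerA expi_unit scale1r.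
    by apply/unitarymxP; have [] := GSU _ Gg.
  (* The trace of a skew-Hermitian matrix is purely imaginary, and subtracting the scalar matrix
     [i a] removes it. *)
  pose a : R := im (\tr Z) / n.+1%:R.
  have trZ : \tr Z = imagC R * realC (im (\tr Z)).
    have : \tr (Z^t*) = - \tr Z by rewrite Zs raddfN.
    rewrite trace_map_mx mxtrace_tr => /(congr1 (@re R)).
    rewrite re_conj reN => /eqP; rewrite -subr_eq0 opprK -mulr2n mulrn_eq0 /=.
    by move=> /eqP r0; rewrite [LHS]reim_split r0 raddf0 add0r.
  have /GT[c [c' [Gc dc cc' c0 c'0]]] : su R n.+1 (Z - (imagC R * realC a)%:M).
    split.
      rewrite ctrmxD ctrmxN Zs tr_scalar_mx map_scalar_mx /= opprD; congr (_ - _).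
      rewrite -raddfN; congr (_%:M).
      by apply: reim_eq; rewrite ?reN ?imN ?re_conj ?im_conj ?reM ?imM ?re_real ?im_real
        /re /im /=; ring.
    rewrite raddfB /= mxtrace_scalar trZ /a; apply/eqP; rewrite subr_eq0; apply/eqP.
    by rewrite -mulrnAr -raddfMn -[_ *+ _]mulr_natr divfK// pnatr_eq0.
  (* The phase restores the scalar part [i a] of the velocity [Z]; [c] supplies the traceless
     part. *)
  exists (fun t => (expi (a * t))%:M *m c t), (fun t =>
    (realC (- a * sin (a * t)) *: 1%:M + realC (a * cos (a * t)) *: (imagC R)%:M) *m c t +
    (expi (a * t))%:M *m c' t); split.
  - by move=> t; exists (a * t), (c t); rewrite mul_scalar_mx.
  - by move=> t; exact: has_derivM (@phase_derive a t) (dc t).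
  - have ca : continuous (fun t => a * t).
      by move=> t; apply: cvgM; [exact: cvg_cst | exact: cvg_id].
    have cs (f : R -> R) : continuous f -> continuous (fun t => f (a * t)).
      by move=> cf t; exact: (cvg_comp (fun t => a * t) f (ca t) (cf (a * t))).
    move=> t; apply: (@cvgD _ 'M[C]_n.+1).
      apply: cvg_mulmx; last exact: has_deriv_continuous (dc t).
      apply: (@cvgD _ 'M[C]_n.+1).
        apply: (@continuous_realC_scale _ _ (fun t => - a * sin (a * t))) => u.
        by apply: cvgM; [exact: cvg_cst | exact: (cs _ (@continuous_sin R))].
      apply: (@continuous_realC_scale _ _ (fun t => a * cos (a * t))) => u.
      by apply: cvgM; [exact: cvg_cst | exact: (cs _ (@continuous_cos R))].
    apply: cvg_mulmx; last exact: cc'.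
    exact: has_deriv_continuous (@phase_derive a t).
  - by rewrite mulr0 expi0 mul1mx.
  - rewrite mulr0 sin0 cos0 expi0 c0 c'0 !mulr0 mulr1 raddf0 scale0r add0r mulmx1.
    by rewrite mul1mx scale_scalar_mx mulrC addrCA subrr addr0.
(* Both [X] and [g] have determinant 1, which forces the phase to be a root of unity of order
   dividing [n.+1]. *)
have SG X : SU R n.+1 X -> exists x g,
    [/\ G g, X = expi x *: g & expi x ^+ n.+1 = 1].
  move=> [/UG'[x [g [Gg XE]]] dX]; exists x, g; split => //.
  by move: dX; rewrite XE detZ; have [_ ->] := GSU _ Gg; rewrite mulr1.
have center x : expi x ^+ n.+1 = 1 -> G (expi x)%:M.
  move=> x1.
  pose w : C := expi (x / n.+1%:R).
  have wn : w ^+ n.+1 = expi x.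
    by rewrite /w expiX -[_ *+ n.+1]mulr_natr divfK// pnatr_eq0.
  (* The scalar matrix [w] has the right power but determinant [expi x]. The factor [D] corrects the
     determinant and leaves the power unchanged, its own [n.+1]-th power being 1. *)
  pose D : 'M[C]_n.+1 := diag_mx (\row_j if j == 0 then expi (- x) else 1).
  have Dk k : D ^+ k = diag_mx (\row_j if j == 0 then expi (- x) ^+ k else 1).
    elim: k => [|k IH].
      rewrite expr0 -[LHS]diag_const_mx; congr diag_mx.
      by apply/rowP => j; rewrite !mxE expr0 if_same.
    rewrite exprS IH -[_ * _]/(_ *m _) mulmx_diag; congr diag_mx.
    by apply/rowP => j; rewrite !mxE exprS; case: ifP; rewrite ?mulr1.
  have UD : SU R n.+1 (w *: D).
    split.
      apply/unitarymxP; rewrite ctrmxZ -scalemxAl -scalemxAr scalerA expi_unit scale1r.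
      apply/unitarymxP; rewrite unitary_diag; apply/forallP => j.
      by rewrite !mxE; case: ifP; rewrite ?expi_unit// rmorph1 mulr1.
    rewrite detZ det_diag big_ord_recl big1 => [|j _]; last by rewrite mxE.
    by rewrite mxE eqxx mulr1 wn -expiD subrr expi0.
  (* The unknown phase between [w *: D] and an element [g] of [G] disappears on taking [n.+1]-th
     powers. *)
  have [y [g [Gg wD y1]]] := SG _ UD.
  suff -> : (expi x)%:M = g ^+ n.+1 by exact: GX.
  have : (w *: D) ^+ n.+1 = (expi y *: g) ^+ n.+1 by rewrite wD.
  rewrite !exprZn y1 scale1r wn => <-; rewrite Dk.
  rewrite -scalemx1 -diag_const_mx; congr (_ *: diag_mx _).
  apply/rowP => j; rewrite !mxE; case: ifP => // _.
  by rewrite expiX mulNrn -expi_conj -expiX x1 rmorph1.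
move=> W /SG[x [g [Gg -> x1]]].
by rewrite -mul_scalar_mx; apply: GM => //; exact: center.
Qed.

End SpecialUnitaryGroup.

(** * The Lie algebra of a group of unitary matrices *)

(** Among the matrices whose row space lies in [S], take [A] of maximal rank: a vector of [S]
    outside its row space could be adjoined and would raise the rank. The cokernel matrix of [A]
    then gives the equations of [S]. *)
Lemma subspace_kernel (F : fieldType) m (S : set 'rV[F]_m) :
  S 0 -> (forall u v, S u -> S v -> S (u + v)) -> (forall a u, S u -> S (a *: u)) ->
  exists B : 'M[F]_m, forall v, S v <-> v *m B = 0.
Proof.
move=> S0 SD SZ.
pose P k := `[< exists2 A : 'M[F]_m, \rank A = k & forall v, (v <= A)%MS -> S v >].
have P0 : exists k, P k.
  exists 0%N; apply/asboolP; exists 0; first exact: mxrank0.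
  by move=> v; rewrite submx0 => /eqP ->.
have Pm k : P k -> (k <= m)%N by move=> /asboolP[A <- _]; exact: rank_leq_row.
case: (ex_maxnP P0 Pm) => k /asboolP[A rA SA] kmax.
exists (cokermx A) => v; split=> [Sv|/eqP]; last by rewrite -submxE; exact: SA.
apply/eqP; rewrite -submxE; apply: contraT => vA.
have : P (\rank (A + v)%MS).
  apply/asboolP; exists (A + v)%MS => // w /sub_addsmxP[[a b] ->] /=.
  apply: SD; first by apply: SA; exact: submxMl.
  by rewrite [b]mx11_scalar mul_scalar_mx; exact: SZ.
move/kmax; rewrite -rA leqNgt => /negP[].
have : (A < A + v)%MS by rewrite ltmxE addsmxSl addsmx_sub submx_refl.
by rewrite ltmxErank => /andP[].
Qed.

Section LieAlgebraOf.
Variable R : realType.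
Local Notation C := (Cplx R).
Variable n : nat.
Implicit Types X Y Z : 'M[C]_n.

(** A real subspace of a finite-dimensional space is the kernel of a linear map, hence closed: the
    difference quotients lie in [T] and so does their limit. *)
Lemma real_subspace_deriv (T : set 'M[C]_n) (f : R -> 'M[C]_n) Z :
  T 0 -> (forall X Y, T X -> T Y -> T (X + Y)) ->
  (forall r X, T X -> T (realC r *: X)) ->
  (forall t, T (f t)) -> has_deriv realC f 0 Z -> T Z.
Proof.
move=> T0 TD TZ Tf df.
have [|u v Su Sv|a u Su|B SB] :=
  @subspace_kernel R _ [set v | T (@uncoords R n v)].
- by rewrite /= raddf0.
- by have := TD _ _ Su Sv; rewrite -uncoordsD.
- by have := TZ a _ Su; rewrite -uncoordsZ.
rewrite -[Z]coordsK; apply/(SB (coords Z)).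
have TB X : T X -> coords X *m B = 0.
  by move=> TX; apply/(SB (coords X)); rewrite /= coordsK.
have Tq h : coords (diff_quot realC f 0 h) *m B = 0.
  apply: TB; rewrite /diff_quot -fmorphV; apply: (TZ); apply: TD => //.
  by rewrite -scaleN1r -(rmorphN1 (@realC R)); exact: TZ.
have cq : coords (diff_quot realC f 0 h) @[h --> 0^'] --> coords Z.
  apply/cvg_mxP => i j; rewrite (ord1 i) /coords mxE; under eq_fun do rewrite mxE.
  move/cvg_mxP: df => df.
  by case: (fintype.split j) => k; case/mxvec_indexP: k => a b; rewrite mxvecE mxE;
    under eq_fun do rewrite mxvecE mxE; have /cvg_reimP[] := df a b.
have cB : (fun _ : R => B) @ (0 : R)^' --> B by exact: cvg_cst.
have := cvg_mulmx cq cB.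
rewrite (_ : (fun x => _) = fun=> 0); last exact/funext/Tq.
move=> /(_ _)/= H; apply: (cvg_unique (@norm_hausdorff _ 'rV[R]_(n * n + n * n)) H).
exact: cvg_cst.
Qed.

(** Differentiate at 0 the product of [c] with its adjoint, which is constantly 1. *)
Lemma lie_algebra_of_skew (G : set 'M[C]_n) X :
  (forall Y, G Y -> Y \is unitarymx) -> lie_algebra_of G X -> X^t* = - X.
Proof.
move=> GU [c [c' [Gc dc _ c0 <-]]].
have d1 := has_derivM (dc 0) (has_deriv_adj (dc 0)).
have d2 := has_deriv_cst (1%:M : 'M[C]_n) (0 : R).
have E : (fun s => c s *m (c s)^t*) = fun=> 1%:M.
  by apply/funext => s; apply/unitarymxP; exact: GU.
rewrite E in d1; have := has_deriv_unique d1 d2.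
by rewrite c0 ctrmx1 mulmx1 mul1mx addrC => /eqP; rewrite addr_eq0 => /eqP.
Qed.

(** Sums come from products of curves, real multiples from a linear change of parameter, and
    brackets from differentiating conjugation along a curve. *)
Lemma lie_algebra_of_group (G : set 'M[C]_n) :
  G 1%:M -> (forall X Y, G X -> G Y -> G (X *m Y)) ->
  (forall X, G X -> X \is unitarymx) -> (forall X, G X -> G (X^t*)) ->
  real_lie_subalgebra (lie_algebra_of G).
Proof.
move=> G1 GM GU GV.
have T0 : lie_algebra_of G 0.
  exists (fun=> 1%:M), (fun=> 0); split=> [//|t|||//].
  - exact: has_deriv_cst.
  - exact: cst_continuous.
  - reflexivity.
have TD X Y : lie_algebra_of G X -> lie_algebra_of G Y -> lie_algebra_of G (X + Y).
  move=> [c [c' [Gc dc cc' c0 <-]]] [d [d' [Gd dd cd' d0 <-]]].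
  exists (fun t => c t *m d t), (fun t => c' t *m d t + c t *m d' t); split.
  - by move=> t; exact: GM.
  - by move=> t; exact: has_derivM.
  - move=> t; apply: (@cvgD _ 'M[C]_n).
      apply: cvg_mulmx; [exact: cc' | exact: has_deriv_continuous (dd t)].
    apply: cvg_mulmx; [exact: has_deriv_continuous (dc t) | exact: cd'].
  - by rewrite c0 d0 mulmx1.
  - by rewrite c0 d0 mulmx1 mul1mx.
have TZ (r : R) X : lie_algebra_of G X -> lie_algebra_of G (realC r *: X).
  move=> [c [c' [Gc dc cc' c0 <-]]].
  exists (fun t => c (r * t)), (fun t => (realC r)%:M *m c' (r * t)); split.
  - by move=> t; exact: Gc.
  - move=> t; rewrite mul_scalar_mx.
    have -> : (fun s => c (r * s)) = (fun s => c (r * s + 0)).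
      by apply/funext => s; rewrite addr0.
    by apply: has_deriv_affine; rewrite addr0; exact: dc.
  - move=> t; have cr : (fun _ : R => (realC r)%:M : 'M[C]_n) @ t --> (realC r)%:M.
      exact: cvg_cst.
    apply: cvg_mulmx cr _.
    apply: (cvg_comp (fun s => r * s) c' _ (cc' (r * t))).
    by apply: cvgM; [exact: cvg_cst | exact: cvg_id].
  - by rewrite mulr0.
  - by rewrite mulr0 mul_scalar_mx.
have TAd g X : G g -> lie_algebra_of G X -> lie_algebra_of G (g *m X *m g^t*).
  move=> Gg [c [c' [Gc dc cc' c0 <-]]].
  exists (fun t => g *m c t *m g^t*), (fun t => g *m c' t *m g^t*); split.
  - by move=> t; apply: (GM _ _ (GM _ _ Gg (Gc t))); exact: GV.
  - by move=> t; apply: has_deriv_mulr; exact: has_deriv_mull.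
  - move=> t; have cg : (fun _ : R => g) @ t --> g by exact: cvg_cst.
    have cgV : (fun _ : R => g^t*) @ t --> g^t* by exact: cvg_cst.
    exact: cvg_mulmx (cvg_mulmx cg (cc' t)) cgV.
  - by rewrite c0 mulmx1; apply/unitarymxP; exact: GU.
  - reflexivity.
split; [exact: T0 | exact: TD | exact: TZ | move=> X Y TX TY].
have XV := lie_algebra_of_skew GU TX.
have [c [c' [Gc dc cc' c0 c'0]]] := TX.
(* Conjugates of [Y] by elements of [G] stay in the subspace of velocities. Their derivative at 0 is
   the bracket, because the adjoint of [X] is [- X]. *)
apply: (@real_subspace_deriv _ (fun t => c t *m Y *m (c t)^t*) _ T0 TD TZ).
  by move=> t; exact: TAd.
have := has_derivM (has_deriv_mulr (A := Y) (dc 0)) (has_deriv_adj (dc 0)).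
by rewrite c0 c'0 ctrmx1 mulmx1 mul1mx XV mulmxN.
Qed.

End LieAlgebraOf.

(** * Two-qubit gates *)

Section Kronecker.
Variable R : realType.
Local Notation C := (Cplx R).
Implicit Types A B : 'M[C]_2.

Lemma kronM A B A' B' : kron A B *m kron A' B' = kron (A *m A') (B *m B').
Proof. exact: (@tensmx_mul _ 2 2 2 2 2 2 A B A' B'). Qed.

Lemma kronE A B i j k l :
  kron A B (@mxtens_index 2 2 (i, j)) (@mxtens_index 2 2 (k, l)) = A i k * B j l.
Proof. exact: (@tensmxE _ 2 2 2 2 A B i j k l). Qed.

Lemma kron1 : kron 1%:M 1%:M = 1%:M :> 'M[C]_4.
Proof.
apply/matrixP => i j; case: (@mxtens_indexP 2 2 i) => a b.
case: (@mxtens_indexP 2 2 j) => a' b'; rewrite kronE !mxE.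
by rewrite (can_eq (@mxtens_indexK 2 2)) xpair_eqE mulrnAl mul1r -mulrnA mulnb andbC.
Qed.

Lemma kron_adj A B : (kron A B)^t* = kron (A^t*) (B^t*).
Proof.
apply/matrixP => i j; case: (@mxtens_indexP 2 2 i) => a b.
case: (@mxtens_indexP 2 2 j) => a' b'; rewrite [RHS]kronE [LHS]mxE [in LHS]mxE.
by rewrite kronE rmorphM !mxE.
Qed.

Lemma kronDl A A' B : kron (A + A') B = kron A B + kron A' B.
Proof. by apply/matrixP => i j; rewrite !mxE mulrDl. Qed.

Lemma kronDr A B B' : kron A (B + B') = kron A B + kron A B'.
Proof. by apply/matrixP => i j; rewrite !mxE mulrDr. Qed.

Lemma kronZl a A B : kron (a *: A) B = a *: kron A B.
Proof. by apply/matrixP => i j; rewrite !mxE mulrA. Qed.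

Lemma kronZr a A B : kron A (a *: B) = a *: kron A B.
Proof. by apply/matrixP => i j; rewrite !mxE mulrCA. Qed.

Lemma kron_diag (d e : 'rV[C]_2) : kron (diag_mx d) (diag_mx e) =
  diag_mx (\row_k (d 0 (@mxtens_unindex 2 2 k).1 * e 0 (@mxtens_unindex 2 2 k).2)).
Proof.
apply/matrixP => i j; case: (@mxtens_indexP 2 2 i) => a b.
case: (@mxtens_indexP 2 2 j) => a' b'; rewrite kronE !mxE !mxtens_indexK /=.
rewrite (can_eq (@mxtens_indexK 2 2)) xpair_eqE.
by case: (a == a'); case: (b == b'); rewrite ?mulr1n ?mulr0n ?mulr0 ?mul0r.
Qed.

Lemma det_kron_diag (d e : 'rV[C]_2) :
  \det (kron (diag_mx d) (diag_mx e)) = (\det (diag_mx d) * \det (diag_mx e)) ^+ 2.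
Proof.
rewrite kron_diag !det_diag.
rewrite (reindex (@mxtens_index 2 2)); last first.
  by exists (@mxtens_unindex 2 2) => i _; rewrite (mxtens_indexK, mxtens_unindexK).
rewrite (eq_bigr (fun ij => d 0 ij.1 * e 0 ij.2)); last first.
  by move=> ij _; rewrite mxE mxtens_indexK.
rewrite -(pair_bigA _ (fun i j => d 0 i * e 0 j)) /=.
by rewrite !big_ord_recl !big_ord0; ring.
Qed.

Lemma det_conj n (D P Q : 'M[C]_n) : Q *m P = 1%:M -> \det (Q *m D *m P) = \det D.
Proof.
by move=> QP; rewrite !det_mulmx mulrAC -det_mulmx QP det1 mul1r.
Qed.

(** Diagonalizing both factors reduces this to diagonal matrices; the exponent 2 is the size of the
    other factor. *)
Lemma det_kron A B : A \is unitarymx -> B \is unitarymx ->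
  \det (kron A B) = (\det A * \det B) ^+ 2.
Proof.
move=> /unitary_diagonalization[P [Q [d [_ _ PQ QP ->]]]].
move=> /unitary_diagonalization[P' [Q' [d' [_ _ PQ' QP' ->]]]].
rewrite (det_conj _ QP) (det_conj _ QP') -!kronM det_conj ?det_kron_diag//.
by rewrite kronM QP QP' kron1.
Qed.

Lemma SU_adj n (A : 'M[C]_n) : SU R n A -> SU R n (A^t*).
Proof.
by move=> [UA dA]; split; rewrite ?trmxC_unitary// det_map_mx det_tr dA rmorph1.
Qed.

Lemma kron_SU A B : SU R 2 A -> SU R 2 B -> SU R 4 (kron A B).
Proof.
move=> [UA dA] [UB dB]; split; last by rewrite det_kron// dA dB mulr1 expr1n.
by apply/unitarymxP; rewrite kron_adj kronM (unitarymxP UA) (unitarymxP UB) kron1.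
Qed.

End Kronecker.

(** * Rotations generated by the Pauli matrices *)

Section Rotations.
Variable R : realType.
Local Notation C := (Cplx R).

(** When [P] squares to -1, as [i] times a Pauli matrix does, this curve is the exponential of
    [t P]. *)
Lemma lie_algebra_of_rotation n (G : set 'M[C]_n) (P : 'M[C]_n) :
  (forall t, G (realC (cos t) *: 1%:M + realC (sin t) *: P)) -> lie_algebra_of G P.
Proof.
move=> GP; exists (fun t => realC (cos t) *: 1%:M + realC (sin t) *: P).
exists (fun t => realC (- sin t) *: 1%:M + realC (cos t) *: P); split.
- exact: GP.
- by move=> t; apply: has_derivD; apply: has_derivZ.
- move=> t; apply: (@cvgD _ 'M[C]_n).
    apply: (@continuous_realC_scale _ _ _ (fun t => - sin t)) => u.
    by apply: cvgN; exact: continuous_sin.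
  exact: continuous_realC_scale (@continuous_cos R) t.
- by rewrite cos0 sin0 raddf0 scale0r addr0 scale1r.
- by rewrite cos0 sin0 oppr0 raddf0 scale0r add0r scale1r.
Qed.

Definition is_pauli (P : 'M[C]_2) :=
  [/\ P^t* = P, P *m P = 1%:M, \tr P = 0 & \det P = -1].

Lemma imagC_conj : (imagC R)^* = - imagC R.
Proof. by apply: reim_eq; rewrite ?re_conj ?im_conj ?reN ?imN /re /im /= ?oppr0. Qed.

Lemma imagC_sqr : imagC R * imagC R = -1.
Proof. by apply: reim_eq; rewrite ?reM ?imM ?reN ?imN /re /im /=; ring. Qed.

Lemma det_mx2 (K : comNzRingType) (A : 'M[K]_2) :
  \det A = A 0 0 * A 1 1 - A 0 1 * A 1 0.
Proof.
rewrite (expand_det_row _ 0) !big_ord_recl big_ord0 /cofactor !det_mx11 !mxE /=.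
rewrite expr0 expr1 mul1r addr0 mulN1r mulrN.
by congr (A _ _ * A _ _ - A _ _ * A _ _); apply: val_inj.
Qed.

Lemma trace_mx2 (K : nzRingType) (A : 'M[K]_2) : \tr A = A 0 0 + A 1 1.
Proof.
rewrite /mxtrace !big_ord_recl big_ord0 addr0.
by congr (A _ _ + A _ _); apply: val_inj.
Qed.

Lemma pauli_comb_SU2 (P : 'M[C]_2) (a b : C) : is_pauli P ->
  a^* = a -> b^* = - b -> a * a - b * b = 1 -> SU R 2 (a *: 1%:M + b *: P).
Proof.
move=> [Ph PP trP dP] ca cb ab; split.
  apply/unitarymxP.
  have -> : (a *: 1%:M + b *: P)^t* = a *: 1%:M - b *: P.
    by rewrite ctrmxD !ctrmxZ ctrmx1 Ph ca cb scaleNr.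
  have bP : (b *: P) *m (b *: P) = (b * b) *: 1%:M.
    by rewrite -scalemxAl -scalemxAr PP scalerA.
  have aX X : (a *: 1%:M) *m X = a *: X by rewrite -scalemxAl mul1mx.
  have Pa : (b *: P) *m (a *: 1%:M) = a *: (b *: P) by rewrite -scalemxAr mulmx1.
  by rewrite mulmxDl !mulmxBr bP !aX Pa scalerA addrA subrK -scalerBl ab scale1r.
move: trP dP; rewrite !det_mx2 trace_mx2 !mxE /= !mulr1n !mulr0n.
move: (P 0 0) (P 0 1) (P 1 0) (P 1 1) => p q r s ps pqrs.
have sE : s = - p by apply/eqP; rewrite -addr_eq0 addrC ps.
(* The determinant of [a + b P] has a cross term [a b] times the trace of [P], which vanishes
   here. *)
transitivity (a * a + b * b * (p * s - q * r)); first by rewrite sE; ring.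
by rewrite pqrs mulrN1.
Qed.

Lemma pauli_SU2 (P : 'M[C]_2) t : is_pauli P ->
  SU R 2 (realC (cos t) *: 1%:M + realC (sin t) *: (imagC R *: P)).
Proof.
move=> PP; rewrite scalerA; apply: pauli_comb_SU2 => //; first exact: conj_realC.
  by apply: reim_eq; rewrite ?re_conj ?im_conj ?reN ?imN ?reM ?imM ?re_real ?im_real
    /re /im /=; ring.
rewrite mulrACA imagC_sqr mulrN1 opprK -!rmorphM -rmorphD -!expr2 cos2Dsin2.
exact: rmorph1.
Qed.

(** That [P] squares to 1 is the theorem of Cayley and Hamilton for trace 0 and determinant -1,
    verified entry by entry. *)
Lemma pauliP (P : 'M[C]_2) : P^t* = P -> \tr P = 0 -> \det P = -1 -> is_pauli P.
Proof.
move=> Ph trP dP; split=> //; apply/matrixP.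
move: trP dP; rewrite trace_mx2 det_mx2 => /eqP; rewrite addr_eq0 => /eqP p.
move=> d i j; rewrite mxE !big_ord_recl big_ord0 addr0 mxE.
have l0 : lift ord0 ord0 = 1 :> 'I_2 by apply: val_inj.
have dd : P 0 0 * P 0 0 + P 0 1 * P 1 0 = 1.
  by apply: oppr_inj; rewrite -d p; ring.
case: (fintype.unliftP 0 i) => [i'|] ->; case: (fintype.unliftP 0 j) => [j'|] ->;
  rewrite ?(ord1 i') ?(ord1 j') !l0 /= ?mulr1n ?mulr0n.
- by rewrite -dd p; ring.
- by rewrite p; ring.
- by rewrite p; ring.
- by [].
Qed.

Lemma pauli_half (X : 'M[C]_2) : [set Ix R; Iy R; Iz R] X ->
  exists2 P, is_pauli P & imagC R *: X = realC 2^-1 *: (imagC R *: P).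
Proof.
have half (P : 'M[C]_2) : P^t* = P -> \tr P = 0 -> \det P = -1 ->
    exists2 Q, is_pauli Q &
      imagC R *: (2^-1 *: P) = realC 2^-1 *: (imagC R *: Q).
  move=> hP tP dP; exists P; first exact: pauliP.
  by rewrite !scalerA [imagC R * _]mulrC fmorphV rmorph_nat.
move=> [[->|->]|->]; apply: half.
- by rewrite ctrmxD !trmx_delta !map_delta_mx addrC.
- by rewrite trace_mx2 !mxE /=; ring.
- by rewrite det_mx2 !mxE /=; ring.
- rewrite ctrmxZ ctrmxD ctrmxN !trmx_delta !map_delta_mx imagC_conj scaleNr -scalerN.
  by rewrite opprB.
- by rewrite trace_mx2 !mxE /=; ring.
- by rewrite det_mx2 !mxE /= -[RHS]imagC_sqr; ring.
- by rewrite ctrmxD ctrmxN !trmx_delta !map_delta_mx.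
- by rewrite trace_mx2 !mxE /=; ring.
- by rewrite det_mx2 !mxE /=; ring.
Qed.

End Rotations.

(** * Reversed loops and inverse holonomies *)

Section LoopReversal.
Variable R : realType.

Lemma cvg_reflect (t : R) : (1 - s) @[s --> t] --> (1 - t : R).
Proof. by apply: cvgB; [exact: cvg_cst | exact: cvg_id]. Qed.

Lemma is_derive_reflect (f : R -> R) (t : R) : derivable f (1 - t) 1 ->
  is_derive t (1 : R) (fun s => f (1 - s)) (- derive1 f (1 - t)).
Proof.
move=> df; rewrite derive1E -mulrN1.
apply: (@is_derive1_comp R f (fun s => 1 - s)); first exact: derivableP.
apply/is_derive1_caratheodory; exists (fun=> -1); split=> // [z|]; first by ring.
exact: cvg_cst.
Qed.

Variable M : manifold R.

Lemma C1_curve_reflect (gamma : R -> M) :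
  C1_curve gamma -> C1_curve (fun t => gamma (1 - t)).
Proof.
move=> [cg dg]; split.
  by move=> t; exact: (cvg_comp (fun s => 1 - s) gamma (@cvg_reflect t) (cg (1 - t))).
move=> c t mu cgt; have [dn cd] := dg c (1 - t) mu cgt.
have dn' : \forall s \near t, derivable (Defs.coord c gamma mu) (1 - s) 1.
  by move: dn; apply: (@cvg_reflect t).
split.
  apply: filterS dn' => s ds.
  by have [] := is_derive_reflect ds.
(* Continuity of the new derivative at [t] requires this formula on a neighbourhood of [t], not only
   at [t]. *)
have E : \forall s \near t, - derive1 (Defs.coord c gamma mu) (1 - s) =
    derive1 (Defs.coord c (fun t => gamma (1 - t)) mu) s.
  apply: filterS dn' => s ds; rewrite [RHS]derive1E.
  by have [_ ->] := is_derive_reflect ds.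
rewrite /prop_for /continuous_at -(nbhs_singleton E).
apply: cvg_trans (near_eq_cvg E) _.
apply: cvgN.
exact: (cvg_comp (fun s => 1 - s) (derive1 (Defs.coord c gamma mu))
  (@cvg_reflect t) cd).
Qed.

End LoopReversal.

Section HolonomyInverse.
Variables (R : realType) (H : hilbert R) (k : nat) (S : holonomic_system H k).

(** Run the solution [g] backwards and multiply it on the right by the inverse of [W]. A constant
    right factor preserves the linear equation, and this one normalizes the initial value to 1 and
    makes the final value [W^t*]. *)
Lemma path_ordered_exp_reflect (gamma : R -> hs_param S) (W : 'M[Cplx R]_k) :
  C1_curve gamma -> W \is unitarymx -> path_ordered_exp gamma W ->
  path_ordered_exp (fun t => gamma (1 - t)) (W^t*).
Proof.
move=> [_ dgamma] UW [g [g0 g1 cg dg]].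
exists (fun t => g (1 - t) *m W^t*); split.
- by rewrite subr0 g1; exact/unitarymxP.
- by rewrite subrr g0 mul1mx.
- move/subspace_continuousP: cg => cg; apply/subspace_continuousP => t t01.
  have t01' : `[0, 1]%classic (1 - t) by move: t01; rewrite /= !in_itv /=; lra.
  have gt := cg _ t01'.
  have rt : (1 - s) @[s --> within `[0, 1] (nbhs t)] --> within `[0, 1] (nbhs (1 - t)).
    move=> P wP.
    have wP' : \forall s \near t, `[0, 1]%classic (1 - s) -> P (1 - s).
      exact: (@cvg_reflect R t _ wP).
    suff : \forall s \near t, `[0, 1]%classic s -> P (1 - s) by [].
    apply: filterS wP' => s Ps s01; apply: Ps.
    by move: s01; rewrite /= !in_itv /=; lra.
  have cW : (fun _ : R => W^t*) @ within `[0, 1] (nbhs t) --> W^t* by exact: cvg_cst.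
  apply: cvg_mulmx cW.
  exact: (cvg_comp (fun s => 1 - s) g rt gt).
move=> t c t01 ct.
have t01' : 0 < 1 - t < 1 by lra.
have d1 := dg (1 - t) c t01' ct.
have -> : (fun t => g (1 - t) *m W^t*) = (fun t => g (-1 * t + 1) *m W^t*).
  by apply/funext => s; rewrite mulN1r addrC.
rewrite mulmxA; apply: has_deriv_mulr.
(* Reversal flips the sign of the coordinate velocities, matching the factor -1 that the chain rule
   puts on the derivative of [g]. *)
have -> : - \sum_mu realC (derive1 (Defs.coord c (fun t => gamma (1 - t)) mu) t) *:
      wilczek_zee c mu (gamma (1 - t)) =
    realC (-1) *: - \sum_mu realC (derive1 (Defs.coord c gamma mu) (1 - t)) *:
      wilczek_zee c mu (gamma (1 - t)).
  rewrite rmorphN1 scaleN1r; congr (- _); rewrite -sumrN; apply: eq_bigr => mu _.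
  rewrite -scaleNr -rmorphN; congr (realC _ *: _).
  have [dn _] := dgamma c (1 - t) mu ct.
  by rewrite derive1E; have [_ ->] := is_derive_reflect (nbhs_singleton dn).
rewrite -scalemxAl; have E : -1 * t + 1 = 1 - t by ring.
by have := @has_deriv_affine _ _ _ g (-1) 1 t _; rewrite E; apply.
Qed.

Lemma holonomy_group_adj (W : 'M[Cplx R]_k) :
  W \is unitarymx -> holonomy_group S W -> holonomy_group S (W^t*).
Proof.
move=> UW [gamma [Cg g0 g1] pW]; exists (fun t => gamma (1 - t)).
  split; [exact: C1_curve_reflect | by rewrite subr0 | by rewrite subrr].
exact: path_ordered_exp_reflect.
Qed.

End HolonomyInverse.

(** * The group of implementable matrices and its velocities *)

Section Implementable.
Variables (R : realType) (Q : two_qubit_system R).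

Lemma gate_implementable h : gate Q h -> implementable Q h.
Proof.
move=> Gh; exists [:: h]; first by move=> x; rewrite inE => /eqP ->.
by rewrite big_cons big_nil mulmx1.
Qed.

Lemma implementable1 : implementable Q 1%:M.
Proof. by exists [::]; rewrite ?big_nil. Qed.

Lemma implementableM V W :
  implementable Q V -> implementable Q W -> implementable Q (V *m W).
Proof.
move=> [s Gs ->] [t Gt ->]; exists (s ++ t).
  by move=> h; rewrite mem_cat => /orP[/Gs|/Gt].
elim: {Gs} s => [|h s IH]; first by rewrite big_nil mul1mx.
by rewrite cat_cons !big_cons -mulmxA IH.
Qed.

Lemma implementable_ind (P : set 'M[Cplx R]_4) :
  P 1%:M -> (forall h W, gate Q h -> P W -> P (h *m W)) -> implementable Q `<=` P.
Proof.
move=> P1 PM _ [s + ->]; elim: s => [_|h s IH Gs]; first by rewrite big_nil.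
rewrite big_cons; apply: PM; first by apply: Gs; rewrite mem_head.
by apply: IH => x xs; apply: Gs; rewrite inE xs orbT.
Qed.

Lemma SU1 n : SU R n 1%:M.
Proof. by split; rewrite ?det1//; apply/unitarymxP; rewrite ctrmx1 mulmx1. Qed.

Lemma gate_SU h : gate Q h -> SU R 4 h.
Proof.
move=> [[[W hW <-]|[W hW <-]]|]; last exact: interaction_SU4.
  by apply: kron_SU; [rewrite qubit1_SU2 in hW | exact: SU1].
by apply: kron_SU; [exact: SU1 | rewrite qubit2_SU2 in hW].
Qed.

Lemma implementable_SU : implementable Q `<=` SU R 4.
Proof.
apply: implementable_ind => [|h W /gate_SU[Uh dh] [UW dW]]; first exact: SU1.
by split; [exact: mul_unitarymx | rewrite det_mulmx dh dW mulr1].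
Qed.

Lemma gate_adj h : gate Q h -> gate Q (h^t*).
Proof.
move=> [[[W hW <-]|[W hW <-]]|hW].
- left; left; exists (W^t*); last by rewrite kron_adj ctrmx1.
  by rewrite qubit1_SU2 in hW *; exact: SU_adj.
- left; right; exists (W^t*); last by rewrite kron_adj ctrmx1.
  by rewrite qubit2_SU2 in hW *; exact: SU_adj.
- by right; apply: holonomy_group_adj => //; have [] := interaction_SU4 hW.
Qed.

Lemma implementable_adj W : implementable Q W -> implementable Q (W^t*).
Proof.
move: W; apply: implementable_ind => [|h W Gh IW].
  by rewrite /= ctrmx1; exact: implementable1.
by rewrite /= ctrmxM; apply: implementableM IW _; exact/gate_implementable/gate_adj.
Qed.

Lemma implementable_lie_subalgebra :
  real_lie_subalgebra (lie_algebra_of (implementable Q)).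
Proof.
apply: lie_algebra_of_group.
- exact: implementable1.
- exact: implementableM.
- by move=> X /implementable_SU[].
- exact: implementable_adj.
Qed.

(** Each generator is half the initial velocity of a one-qubit rotation, and every such rotation is
    a gate because the holonomy groups of the qubits are all of SU(2). *)
Lemma local_algebra_implementable :
  local_algebra R `<=` lie_algebra_of (implementable Q).
Proof.
have [_ _ TZ _] := implementable_lie_subalgebra.
apply: smallest_sub; first exact: implementable_lie_subalgebra.
move=> _ [|] [I /pauli_half[P PP]] -> <-; rewrite ?kronZl ?kronZr; apply: TZ;
  apply: lie_algebra_of_rotation => t; apply: gate_implementable; left.
  left; exists (realC (cos t) *: 1%:M + realC (sin t) *: (imagC R *: P)).
    by rewrite qubit1_SU2; exact: pauli_SU2.
  by rewrite kronDl !kronZl kron1.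
right; exists (realC (cos t) *: 1%:M + realC (sin t) *: (imagC R *: P)).
  by rewrite qubit2_SU2; exact: pauli_SU2.
by rewrite kronDr !kronZr kron1.
Qed.

Lemma lie_algebra_of_sub n (G G' : set 'M[Cplx R]_n) :
  G `<=` G' -> lie_algebra_of G `<=` lie_algebra_of G'.
Proof.
move=> GG' X [c [c' [Gc dc cc' c0 cX]]]; exists c, c'; split.
- by move=> t; exact/GG'/Gc.
- exact: dc.
- exact: cc'.
- exact: c0.
- exact: cX.
Qed.

End Implementable.

Theorem theorem2 (R : realType) (Q : two_qubit_system R)
    (hgen : lie_generated (local_algebra R `|` holonomy_algebra (interaction Q))
            = su R 4) :
  exactly_universal Q.
Proof.
apply: SU_sub.
- exact: implementable1.
- exact: implementableM.
- exact: implementable_SU.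
(* The velocities form a real Lie algebra, so it is enough that they include the two generating
   sets. *)
rewrite -hgen; apply: smallest_sub; first exact: implementable_lie_subalgebra.
move=> X [/local_algebra_implementable//|]; apply: lie_algebra_of_sub.
by move=> W hW; apply: gate_implementable; right.
Qed.
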